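(* Let $H\in(0,1)$, $\sigma>0$, $S_0>0$, and let $(S_t)_{t\ge 0}$ be the process $S_t=S_0\exp\big(\sigma(B_t+B^H_t)-\tfrac12\sigma^2(t+t^{2H})\big)$, where $B$ is a standard Brownian motion and $B^H$ is an independent fractional Brownian motion with Hurst parameter $H$. For $N\ge 1$ define $$\hat\sigma^2_N=\frac{1}{N}\Big(\frac1N+\frac1{N^{2H}}\Big)^{-1}\sum_{j=0}^{N-1}\Big(\log\frac{S_{(j+1)/N}}{S_{j/N}}\Big)^2 .$$ Then $\hat\sigma^2_N\to\sigma^2$ almost surely as $N\to\infty$.
   Context: All processes are defined on a common complete probability space $(\Omega,\mathcal F,\mathbb P)$. $B$ is a standard Brownian motion (covariance $s\wedge t$) and $B^H$ is a centered Gaussian fractional Brownian motion with covariance $\frac12(t^{2H}+s^{2H}-|t-s|^{2H})$, independent of $B$. The sum $M_t=B_t+B^H_t$ is the mixed fractional Brownian motion. The observations are the values $S_{j/N}$, $j=0,\dots,N$, of a single path on the equidistant grid of $[0,1]$ with mesh $1/N$ (high-frequency data); the drift parameter is set to $0$. *)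

(* Defs.v *)
From HB Require Import structures.
From mathcomp Require Import all_boot all_order all_algebra.
From mathcomp Require Import all_classical all_reals all_analysis.
Set Implicit Arguments. Unset Strict Implicit. Unset Printing Implicit Defensive.
Import Order.TTheory GRing.Theory Num.Theory.
Import numFieldNormedType.Exports.
Local Open Scope classical_set_scope.
Local Open Scope ring_scope.

Section defs.
Context {R : realType} {d : measure_display} {T : measurableType d}.
Variable P : probability T R.

Definition centered_gaussian (X : T -> R) (v : R) : Prop :=
  measurable_fun setT X /\ 0 <= v /\
  (if v == 0 then P [set w | X w != 0] = 0%E
   else forall A : set R, measurable A ->
          P (X @^-1` A) = normal_prob 0 (Num.sqrt v) A).

Definition centered_gaussian_process (X : R -> T -> R) (K : R -> R -> R) : Prop :=
  forall (n : nat) (t : 'I_n -> R) (a : 'I_n -> R),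
    (forall i, 0 <= t i) ->
    centered_gaussian (fun w => \sum_(i < n) a i * X (t i) w)
                      (\sum_(i < n) \sum_(j < n) a i * a j * K (t i) (t j)).

(* Independence of the processes X and Y (indexed by t >= 0): the
   sigma-algebras they generate are independent, i.e. the product rule
   holds on the generating pi-systems of finite-dimensional cylinders. *)
Definition indep_processes (X Y : R -> T -> R) : Prop :=
  forall (n m : nat) (t : 'I_n -> R) (s : 'I_m -> R)
         (A : 'I_n -> set R) (C : 'I_m -> set R),
    (forall i, 0 <= t i) -> (forall j, 0 <= s j) ->
    (forall i, measurable (A i)) -> (forall j, measurable (C j)) ->
    let E1 := \bigcap_(i in [set: 'I_n]) (X (t i) @^-1` A i) in
    let E2 := \bigcap_(j in [set: 'I_m]) (Y (s j) @^-1` C j) in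
    P (E1 `&` E2) = (P E1 * P E2)%E.

End defs.

Definition bm_cov {R : realType} (s t : R) : R := Order.min s t.

Definition fbm_cov {R : realType} (H : R) (t s : R) : R :=
  (t `^ (2 * H) + s `^ (2 * H) - `|t - s| `^ (2 * H)) / 2.

Definition mixed_price {R : realType} {T : Type} (S0 sigma H : R)
  (B BH : R -> T -> R) (t : R) (w : T) : R :=
  S0 * expR (sigma * (B t w + BH t w) - 2^-1 * sigma ^+ 2 * (t + t `^ (2 * H))).

Definition sigma_hat2 {R : realType} {T : Type} (S : R -> T -> R) (H : R)
  (N : nat) (w : T) : R :=
  (N%:R)^-1 * ((N%:R)^-1 + (N%:R `^ (2 * H))^-1)^-1 *
  \sum_(j < N) (ln (S (j.+1%:R / N%:R) w / S (j%:R / N%:R) w)) ^+ 2.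

(* Main.v *)
Require Import Defs.
From HB Require Import structures.
From mathcomp Require Import all_boot all_order all_algebra.
From mathcomp Require Import all_classical all_reals all_analysis.
From mathcomp Require Import measurable_realfun.
From mathcomp Require Import ring lra.
Set Implicit Arguments. Unset Strict Implicit. Unset Printing Implicit Defensive.
Import Order.TTheory GRing.Theory Num.Theory.
Import numFieldNormedType.Exports.
Local Open Scope classical_set_scope.
Local Open Scope ring_scope.

(* Let N = 1/h, p = 2H, v = h + h^p, and let Y_j be the increments of the mixed
   process over the grid, centered Gaussian with variance v.  The linear span of
   the values of B and B^H on the grid is a Gaussian space.  Polarizing the
   one-dimensional moment recursion E X^(m+1) = m E X^2 E X^(m-1) gives Gaussian
   integration by parts, hence Wick's formula, in this space; it yields
   E (sum_j Y_j^2 - N v)^4 <= 60 (sum_jk E(Y_j Y_k)^2)^2.  By midpoint convexity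
   or concavity of x^p the off-diagonal covariances of the increments of B^H all
   have the same sign, while their total is Var B^H_1 = 1; hence
   sum_jk E(Y_j Y_k)^2 <= 8 N v^2 for every H, and the fourth moments of
   (sum_j Y_j^2) / (N v) - 1 are O(1/N^2), which is summable.  The normalized sum of
   squares of the drift increments of the log-returns is O(1/N), so that by
   AM-GM the drift does not change the limit. *)

(** * Moments of the normal distribution *)

(** Second moments would only bound the variance of the relative error by a multiple of 1/N, which
    is not summable; hence the fourth moments. The hypotheses give laws of linear combinations of
    one process at a time and no joint density, so every joint moment is recovered from
    one-dimensional moments, independence and polarization. The constant 60 counts the pairings of
    i, i, j, j, k, k, l, l that join no index to itself. The obstacle is long memory: for H > 3/4
    the squared covariances of the increments of B^H add up to more than the order N h^(2p).
    Comparing them with v in place of h^p removes it. Since v >= h, one has N v >= 1; if the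
    covariances are nonnegative with total 1, their squares add up to at most h^p <= v <= N v^2. If
    they are nonpositive off the diagonal, the total 1 being positive, the diagonal N h^p controls
    the rest. *)

Section normal_moments.
Context {R : realType}.
Variable s : R.
Hypothesis s0 : s != 0.
Local Notation mu := (@lebesgue_measure R).
Local Notation g := (normal_fun 0 s).

Lemma normal_funE x : g x = expR (- (x ^+ 2 / (s ^+ 2 *+ 2))).
Proof. by rewrite /normal_fun subr0 mulNr. Qed.

Lemma normal_fun_sqrt2 x :
  normal_fun 0 s x = normal_fun 0 (Num.sqrt 2 * s) x ^+ 2.
Proof.
rewrite /normal_fun subr0 -expRM_natl; congr expR.
rewrite exprMn sqr_sqrtr// -[in RHS]mulr_natr -[in LHS]mulr_natr.
by field; rewrite s0.
Qed.

(* Splitting the Gaussian weight as a square, one factor absorbs the power. *)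
Lemma pow_normal_fun_bound m : exists2 C : R, 0 <= C &
  forall x, `|x| ^+ m * g x <= C * normal_fun 0 (Num.sqrt 2 * s) x.
Proof.
(* With this [c], [y = x ^+ 2 / c] is the exponent of the wider weight, of variance [2 * s ^+ 2]. *)
pose c := s ^+ 2 * 4.
have c0 : 0 < c by rewrite /c mulr_gt0// exprn_even_gt0/=.
(* From [|x| ^+ m <= 1 + (x ^+ 2) ^+ m], with [x ^+ 2 = c * y] and [y ^+ m / m! <= expR y]. *)
exists (1 + c ^+ m * m`!%:R) => [|x].
  by rewrite addr_ge0// mulr_ge0// exprn_ge0// ltW.
rewrite normal_fun_sqrt2 expr2 mulrA ler_wpM2r ?normal_fun_ge0//.
pose y := x ^+ 2 / c.
have y0 : 0 <= y by rewrite /y divr_ge0 ?sqr_ge0// ltW.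
have -> : normal_fun 0 (Num.sqrt 2 * s) x = expR (- y).
  rewrite /normal_fun subr0; congr expR.
  rewrite exprMn sqr_sqrtr// /y /c -[in LHS]mulr_natr.
  by field; rewrite s0.
rewrite expRN ler_pdivrMr ?expR_gt0//.
have xm : `|x| ^+ m <= 1 + (x ^+ 2) ^+ m.
  rewrite -exprM mulnC exprM -[x ^+ m ^+ 2]real_normK ?num_real// normrX.
  set z := `|x| ^+ m; have z0 : 0 <= z by rewrite exprn_ge0.
  nra.
apply: (le_trans xm).
have -> : x ^+ 2 = c * y by rewrite /y mulrC mulfVK// gt_eqF.
rewrite exprMn mulrDl mul1r lerD//.
  by have := expR_ge1Dx y; lra.
rewrite -mulrA ler_wpM2l// ?exprn_ge0 ?(ltW c0)//.
case: m xm => [|m] _; first by rewrite expr0 fact0 mul1r; apply: le_trans (expR_ge1Dx _); rewrite lerDl.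
rewrite mulrC -ler_pdivrMr ?ltr0n ?fact_gt0//.
by apply: le_trans (expR_ge1Dxn m y0); rewrite lerDr.
Qed.

Lemma integrable_pow_normal_fun m :
  mu.-integrable setT (EFin \o (fun x => x ^+ m * g x)).
Proof.
have [C C0 hC] := pow_normal_fun_bound m.
have s20 : Num.sqrt 2 * s != 0 by rewrite mulf_neq0// gt_eqF// sqrtr_gt0.
apply: (@le_integrable _ _ _ mu _ _ _
  (fun x => (C%:E * (normal_fun 0 (Num.sqrt 2 * s) x)%:E)%E)) => //.
- apply/measurable_EFinP; apply: measurable_funM; first exact: measurable_funX.
  exact: measurable_normal_fun.
- move=> x _ /=; rewrite lee_fin normrM normrX.
  rewrite (ger0_norm (normal_fun_ge0 _ _ _)) [leRHS]ger0_norm//.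
  by rewrite mulr_ge0// normal_fun_ge0.
- apply: integrableZl => //.
  have := integrable_normal_pdf 0 (Num.sqrt 2 * s).
  rewrite normal_pdfE// => /(integrableZl measurableT (normal_peak (Num.sqrt 2 * s))^-1).
  apply: eq_integrable => // x _ /=.
  by rewrite -EFinM mulKf// gt_eqF// normal_peak_gt0.
Qed.

Lemma is_derive_normal_fun (x : R) :
  is_derive x 1 g (- (x / s ^+ 2) * g x).
Proof.
rewrite (_ : g = expR \o (fun x => - (x ^+ 2 / (s ^+ 2 *+ 2)))); last first.
  by apply/funext => y; rewrite normal_funE.
apply: is_derive_eq.
rewrite scaler0 add0r -[_ *: _]/(_ * (x * 1 + x * 1)) /= -mulr_natr.
set e := expR _; field.
by rewrite s0.
Qed.

Let F m (x : R) := x ^+ m * g x.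
(** The derivative of [F m]; at [m = 0] the truncated [m.-1] is harmless, its coefficient being
    0. *)
Let f m (x : R) := m%:R * F m.-1 x - F m.+1 x / s ^+ 2.

Lemma is_derive_pow_normal_fun m (x : R) : is_derive x 1 (F m) (f m x).
Proof.
have ? := is_derive_normal_fun x.
have h := is_deriveM (is_deriveX m (is_derive_id x (1 : R)))
  (is_derive_normal_fun x).
have FE : (id ^+ m : R -> R) * g = F m.
  apply/funext => y; rewrite /F; congr (_ * _).
  by elim: m {h} => // m IH; rewrite !exprS -IH.
rewrite FE in h; apply: (is_derive_eq h).
have -> : (id ^+ m : R -> R) x = x ^+ m.
  by elim: m {h FE} => // m IH; rewrite !exprS -IH.
rewrite -[LHS]/(x ^+ m * (- (x / s ^+ 2) * g x) +
  g x * ((m%:R * x ^+ m.-1) * 1)).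
rewrite /f /F [x ^+ m.+1]exprS.
by set a := x ^+ m.-1; set b := x ^+ m; ring.
Qed.

Lemma continuous_pow_normal_fun m : continuous (F m).
Proof.
move=> x; apply: differentiable_continuous.
by apply/derivable1_diffP; have [] := is_derive_pow_normal_fun m x.
Qed.

(** The bound for the exponent [m.+1] gives [|F m x| <= C / |x|]. Only [|u n|] is required to
    diverge, so that both ends of a growing interval are covered. *)
Lemma cvg_pow_normal_fun0 m (u : R ^nat) : (fun n => `|u n|) @ \oo --> +oo ->
  (fun n => F m (u n)) @ \oo --> (0 : R).
Proof.
move=> uoo.
have [C C0 hC] := pow_normal_fun_bound m.+1.
apply/norm_cvg0P.
apply: (@squeeze_cvgr _ _ _ _ (cst 0) (fun n => C * `|u n|^-1)); last 2 first.
- exact: cvg_cst.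
- rewrite -[0](mulr0 C); apply: cvgM; first exact: cvg_cst.
  by apply/gtr0_cvgV0 => //; near=> n; near: n; exact: cvgry_gt.
near=> n.
rewrite normr_ge0/=.
have un : 0 < `|u n| by near: n; exact: cvgry_gt.
rewrite /F normrM normrX (ger0_norm (normal_fun_ge0 _ _ _)) ler_pdivlMr//.
rewrite mulrAC -exprSr (le_trans (hC _))// ler_piMr//.
rewrite /normal_fun subr0 -expR0 ler_expR mulNr oppr_le0.
by rewrite divr_ge0 ?sqr_ge0// mulrn_wge0// sqr_ge0.
Unshelve. all: by end_near. Qed.

(** On a bounded interval the integral is a difference of boundary values of [F m], which vanish in
    the limit; dominated convergence, with [|f m|] as the bound, passes to the whole line. *)
Lemma integral_deriv_pow_normal_fun m : (\int[mu]_x (f m x)%:E = 0)%E.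
Proof.
have mF k : measurable_fun setT (F k).
  by apply: measurable_funM; [exact: measurable_funX|exact: measurable_normal_fun].
have cf : continuous (f m).
  move=> x; apply: cvgB; apply: cvgM; try exact: cvg_cst;
    exact: continuous_pow_normal_fun.
have mf : measurable_fun setT (f m) by exact: continuous_measurable_fun.
have intf : mu.-integrable setT (EFin \o f m).
  have h1 := integrableZl measurableT m%:R (integrable_pow_normal_fun m.-1).
  have h2 := integrableZl measurableT (s ^+ 2)^-1 (integrable_pow_normal_fun m.+1).
  have := integrableB measurableT h1 h2.
  apply: eq_integrable => // x _ /=.
  by rewrite /f -!EFinM -EFinB [in RHS]mulrC [X in _ - X]mulrC (mulrC _ m%:R).
(* [n.+1] keeps the interval nondegenerate from the start. *)
pose J (n : nat) := `[- n.+1%:R, n.+1%:R : R]%classic.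
pose fn (n : nat) := EFin \o (f m \_ (J n)).
have [] := @dominated_convergence _ _ _ mu _ measurableT
    fn (EFin \o f m) (fun x => `|(EFin \o f m) x|%E).
- move=> n; apply/measurable_EFinP.
  apply/(measurable_restrictT _ _).1; first exact: measurable_itv.
  exact: measurable_funTS.
- exact/measurable_EFinP.
- apply: aeW => x _; apply: cvg_near_cst; near=> n.
  rewrite /fn /= patchE ifT// inE /J/= in_itv/= -ler_norml.
  apply: (@le_trans _ _ n%:R); last by rewrite ler_nat.
  by near: n; exact: nbhs_infty_ger.
- exact: integrable_abse.
- apply: aeW => x n _; rewrite /fn /= patchE; case: ifP => //.
  by rewrite normr0 lee_fin.
move=> _ _ h.
have e n : (\int[mu]_x (fn n x) = (F m n.+1%:R - F m (- n.+1%:R))%:E)%E.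
  rewrite /fn.
  rewrite (_ : EFin \o f m \_ (J n) = (EFin \o f m) \_ (J n)); last first.
    by rewrite restrict_EFin.
  rewrite -integral_mkcond /J (@continuous_FTC2 _ (f m) (F m))//.
  - by apply: (@lt_trans _ _ 0); rewrite ?oppr_lt0 ltr0n.
  - exact: continuous_subspaceT.
  - split.
    + by move=> x _; have [] := is_derive_pow_normal_fun m x.
    + exact/cvg_at_right_filter/continuous_pow_normal_fun.
    + exact/cvg_at_left_filter/continuous_pow_normal_fun.
  - by move=> x _; rewrite derive1E; have [] := is_derive_pow_normal_fun m x.
apply: cvg_unique h _ => //=.
under eq_fun do rewrite e.
apply/fine_cvgP; split; first by near=> n.
have oo : (fun n : nat => n.+1%:R : R) @ \oo --> +oo.
  by rewrite (cvg_shiftS (fun n => n%:R : R)); exact: cvgr_idn.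
rewrite -[0](subrr 0); apply: cvgB; apply: cvg_pow_normal_fun0.
  by under eq_fun do rewrite normr_nat.
by under eq_fun do rewrite normrN normr_nat.
Unshelve. all: by end_near. Qed.

Lemma normal_fun_moment m :
  (\int[mu]_x (x ^+ m.+1 * g x) = m%:R * s ^+ 2 * \int[mu]_x (x ^+ m.-1 * g x))%R.
Proof.
have i1 := integrable_pow_normal_fun m.-1.
have i2 := integrable_pow_normal_fun m.+1.
have h1 := integrableZl measurableT m%:R i1.
have h2 := integrableZl measurableT (s ^+ 2)^-1 i2.
have : (\int[mu]_x f m x = 0)%R.
  by rewrite /Rintegral integral_deriv_pow_normal_fun.
have -> : f m = (fun x : R =>
    m%:R * (x ^+ m.-1 * g x) - (s ^+ 2)^-1 * (x ^+ m.+1 * g x)).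
  by apply/funext => x; rewrite /f /F (mulrC (s ^+ 2)^-1).
rewrite RintegralB// !RintegralZl//.
move=> /eqP; rewrite subr_eq0 => /eqP /(congr1 (fun y => s ^+ 2 * y)).
by rewrite mulVKf ?sqrf_eq0// => <-; ring.
Qed.

End normal_moments.

(** * Integration against a normal law *)

Section normal_density.
Context {R : realType}.
Local Notation mu := (@lebesgue_measure R).
Variables m s : R.

(** Both functions have the same integral over every measurable set. Change of variables is
    available for the Radon-Nikodym derivative; this carries it over to the explicit density. *)
Lemma ae_eq_normal_density :
  ae_eq mu setT (Radon_Nikodym_SigmaFinite.f (normal_prob m s) mu)
    (EFin \o normal_pdf m s).
Proof.
have dom := normal_prob_dominates m s.
apply: integral_ae_eq => //.
- exact: Radon_Nikodym_SigmaFinite.f_integrable.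
- by apply/measurable_EFinP; exact: measurable_normal_pdf.
- by move=> E _ mE; rewrite -Radon_Nikodym_SigmaFinite.f_integral.
Qed.

Lemma ge0_integral_normal_prob (f : R -> \bar R) : measurable_fun setT f ->
  (forall x, 0 <= f x)%E ->
  (\int[normal_prob m s]_x f x = \int[mu]_x (f x * (normal_pdf m s x)%:E))%E.
Proof.
move=> mf f0; have dom := normal_prob_dominates m s.
have mpdf : measurable_fun setT (EFin \o normal_pdf m s).
  by apply/measurable_EFinP; exact: measurable_normal_pdf.
rewrite -(Radon_Nikodym_SigmaFinite.change_of_variables dom)//.
apply: ae_eq_integral => //.
- apply: emeasurable_funM => //.
  exact: measurable_int (Radon_Nikodym_SigmaFinite.f_integrable dom).
- exact: emeasurable_funM.
- exact/ae_eqe_mul2l/ae_eq_normal_density.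
Qed.

Lemma integrable_normal_prob (f : R -> R) : measurable_fun setT f ->
  mu.-integrable setT (EFin \o (fun x => f x * normal_pdf m s x)) ->
  (normal_prob m s).-integrable setT (EFin \o f).
Proof.
move=> mf /integrableP[_ fi]; apply/integrableP; split.
  exact/measurable_EFinP.
rewrite ge0_integral_normal_prob//; last first.
  by apply/measurable_EFinP; exact: measurableT_comp.
apply: le_lt_trans fi; rewrite le_eqVlt; apply/orP; left; apply/eqP.
apply: eq_integral => x _ /=.
by rewrite -EFinM normrM (ger0_norm (normal_pdf_ge0 _ _ _)).
Qed.

Lemma integral_normal_prob (f : R -> R) : measurable_fun setT f ->
  mu.-integrable setT (EFin \o (fun x => f x * normal_pdf m s x)) ->
  \int[normal_prob m s]_x f x = \int[mu]_x (f x * normal_pdf m s x).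
Proof.
move=> mf fi; congr fine.
have mpdf : measurable_fun setT (EFin \o normal_pdf m s).
  by apply/measurable_EFinP; exact: measurable_normal_pdf.
rewrite integralE [RHS]integralE; congr (_ - _)%E.
- rewrite ge0_integral_normal_prob//; last first.
    exact/measurable_funepos/measurable_EFinP.
  apply: eq_integral => x _; rewrite !funeposE -!EFin_max -EFinM.
  rewrite maxr_pMl ?mul0r//; exact: normal_pdf_ge0.
- rewrite ge0_integral_normal_prob//; last first.
    exact/measurable_funeneg/measurable_EFinP.
  apply: eq_integral => x _; rewrite !funenegE -!EFinN -!EFin_max -EFinM.
  rewrite maxr_pMl ?mul0r ?mulNr//; exact: normal_pdf_ge0.
Qed.

End normal_density.

(** * Moments of centered Gaussian variables *)

Section gaussian_moments.
Context {R : realType} {d : measure_display} {T : measurableType d}.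
Variable P : probability T R.

(** Requiring all powers makes the class an algebra, so that integrability of any polynomial in the
    processes follows by closure. *)
Definition has_moments (X : T -> R) := measurable_fun setT X /\
  forall n, P.-integrable setT (EFin \o (fun w => X w ^+ n)).

Lemma integrable_pow_normal_prob (s : R) n : s != 0 ->
  (@lebesgue_measure R).-integrable setT
    (EFin \o (fun x : R => x ^+ n * normal_pdf 0 s x)).
Proof.
move=> s0; have := integrable_pow_normal_fun s0 n.
move=> /(integrableZl measurableT (normal_peak s)).
apply: eq_integrable => // x _ /=.
by rewrite normal_pdfE// -EFinM mulrCA.
Qed.

Lemma normal_prob_moment (s : R) n : s != 0 ->
  \int[normal_prob 0 s]_x (x ^+ n.+1) =
  n%:R * s ^+ 2 * \int[normal_prob 0 s]_x (x ^+ n.-1).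
Proof.
move=> s0.
have mX k : measurable_fun [set: R] (fun x : R => x ^+ k) by exact: measurable_funX.
rewrite !integral_normal_prob//; try exact: integrable_pow_normal_prob.
have e k : \int[lebesgue_measure]_x (x ^+ k * normal_pdf 0 s x) =
    normal_peak s * \int[lebesgue_measure]_x (x ^+ k * normal_fun 0 s x).
  rewrite -RintegralZl//; last exact: integrable_pow_normal_fun.
  by apply: eq_Rintegral => x _; rewrite normal_pdfE// mulrCA.
by rewrite !e normal_fun_moment//; ring.
Qed.

(** [centered_gaussian] refers to [normal_prob] only for nonzero variance; the degenerate case is
    handled through almost sure vanishing. *)
Lemma centered_gaussian_law (X : T -> R) v : v != 0 ->
  centered_gaussian P X v -> forall (mX : measurable_fun setT X)
    (f : R -> R), measurable_fun setT f ->
  (normal_prob 0 (Num.sqrt v)).-integrable setT (EFin \o f) ->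
  P.-integrable setT (EFin \o (f \o X)) /\
  \int[P]_w f (X w) = \int[normal_prob 0 (Num.sqrt v)]_x f x.
Proof.
move=> v0 [_ [_]]; rewrite (negbTE v0) => XP mX f mf /integrableP[_ fi].
pose Xm : {mfun T >-> measurableTypeR R} :=
  HB.pack X (isMeasurableFun.Build _ _ _ (measurableTypeR R) X mX).
have eP (h : R -> \bar R) :
    (\int[distribution P Xm]_x h x = \int[normal_prob 0 (Num.sqrt v)]_x h x)%E.
  by apply: eq_measure_integral => A mA _; exact: XP.
have Pf : P.-integrable setT (EFin \o (f \o X)).
  apply/integrableP; split.
    by apply/measurable_EFinP; exact: measurableT_comp.
  move: fi; rewrite -eP (@ge0_integral_distribution _ _ _ _ _ _ Xm)//.
  by apply/measurable_EFinP; exact: measurableT_comp.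
split=> //; congr fine; rewrite -eP (@integral_distribution _ _ _ _ _ _ Xm)//.
exact/measurable_EFinP.
Qed.

Lemma centered_gaussian0 (X : T -> R) : centered_gaussian P X 0 ->
  ae_eq P setT X (cst 0).
Proof.
move=> [mX [_]]; rewrite eqxx => PX.
exists [set w | X w != 0]; split => //.
- rewrite (_ : [set _ | _] = X @^-1` ~` [set 0]); last first.
    by apply/seteqP; split => w /= /eqP.
  by rewrite -[X in measurable X]setTI; apply: mX => //; exact: measurableC.
- by move=> w /= /not_implyP[_ /eqP].
Qed.

Lemma centered_gaussian_has_moments X v :
  centered_gaussian P X v -> has_moments X.
Proof.
move=> gX; have [mX [v0 _]] := gX; split=> // n.
have mXn : measurable_fun setT (fun w => X w ^+ n) by exact: measurable_funX.
have [v00|vN0] := eqVneq v 0; last first.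
  have sv : Num.sqrt v != 0 by rewrite gt_eqF// sqrtr_gt0 lt_neqAle eq_sym vN0.
  have mn : measurable_fun [set: R] (fun x : R => x ^+ n) by exact: measurable_funX.
  have [] // := centered_gaussian_law vN0 gX mX mn.
  apply: integrable_normal_prob => //.
  exact: integrable_pow_normal_prob.
subst v; have X0 := centered_gaussian0 gX.
apply/integrableP; split; first exact/measurable_EFinP.
rewrite (ae_eq_integral (cst (`|0 ^+ n : R|)%:E))//.
- by rewrite integral_cst// [X in (_ * X)%E](@probability_setT _ _ _ P) mule1 ltry.
- by apply/measurable_EFinP; exact: measurableT_comp.
- by apply: filterS X0 => w h _; rewrite /= h.
Qed.

Lemma centered_gaussian_moment X v n : centered_gaussian P X v ->
  \int[P]_w (X w ^+ n.+1) = n%:R * v * \int[P]_w (X w ^+ n.-1).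
Proof.
move=> gX; have [mX [v0 _]] := gX.
have [v00|vN0] := eqVneq v 0; last first.
  have sv : Num.sqrt v != 0 by rewrite gt_eqF// sqrtr_gt0 lt_neqAle eq_sym vN0.
  have h k : \int[P]_w (X w ^+ k) = \int[normal_prob 0 (Num.sqrt v)]_x (x ^+ k).
    have mk : measurable_fun [set: R] (fun x : R => x ^+ k) by exact: measurable_funX.
    have [] // := centered_gaussian_law vN0 gX mX mk.
    apply: integrable_normal_prob => //.
    exact: integrable_pow_normal_prob.
  by rewrite !h normal_prob_moment// sqr_sqrtr.
(* At variance 0 both sides vanish: the exponent on the left is positive, and the right has the
   factor [v]. *)
subst v; have X0 := centered_gaussian0 gX.
rewrite mulr0 mul0r /Rintegral (ae_eq_integral (cst 0%E))//.
- by rewrite integral0.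
- by apply/measurable_EFinP; exact: measurable_funX.
- by apply: filterS X0 => w h _; rewrite h// expr0n.
Qed.

End gaussian_moments.

(** * Random variables with moments of all orders *)

Section moment_algebra.
Context {R : realType} {d : measure_display} {T : measurableType d}.
Variable P : probability T R.
Local Notation has_moments := (has_moments P).
Implicit Types X Y : T -> R.

(** Domination by squares, [|x y| <= x ^ 2 + y ^ 2], reduces a mixed monomial to even powers of each
    factor. *)
Lemma has_moments_integrableM X Y a b : has_moments X -> has_moments Y ->
  P.-integrable setT (EFin \o (fun w => X w ^+ a * Y w ^+ b)).
Proof.
move=> [mX iX] [mY iY].
apply: (@le_integrable _ _ _ P _ _ _
  (fun w => ((X w ^+ (a * 2))%:E + (Y w ^+ (b * 2))%:E)%E)) => //.
- by apply/measurable_EFinP; apply: measurable_funM; exact: measurable_funX.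
- move=> w _ /=; rewrite lee_fin !exprM normrM.
  rewrite [leRHS]ger0_norm ?addr_ge0 ?sqr_ge0//.
  rewrite -(real_normK (num_real (X w ^+ a))) -(real_normK (num_real (Y w ^+ b))).
  set x := `|X w ^+ a|; set y := `|_|; nra.
- exact: integrableD (iX _) (iY _).
Qed.

Lemma has_momentsM X Y : has_moments X -> has_moments Y ->
  has_moments (fun w => X w * Y w).
Proof.
move=> hX hY; split; first by apply: measurable_funM; [case: hX|case: hY].
move=> n; apply: eq_integrable (has_moments_integrableM n n hX hY) => // w _.
by rewrite /= exprMn.
Qed.

Lemma has_moments_cst c : has_moments (cst c).
Proof.
by split=> // n; apply: eq_integrable (finite_measure_integrable_cst P (c ^+ n) _).
Qed.

Lemma has_momentsZ c X : has_moments X -> has_moments (fun w => c * X w).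
Proof. by move=> hX; exact: has_momentsM (has_moments_cst c) hX. Qed.

Lemma has_momentsD X Y : has_moments X -> has_moments Y ->
  has_moments (fun w => X w + Y w).
Proof.
move=> hX hY; split; first by apply: measurable_funD; [case: hX|case: hY].
move=> n.
have -> : (EFin \o (fun w => (X w + Y w) ^+ n)) =
    (fun w => (\sum_(i < n.+1) ('C(n, i)%:R%:E * (X w ^+ (n - i) * Y w ^+ i)%:E))%E).
  apply/funext => w /=; rewrite exprDn -sumEFin; apply: eq_bigr => i _.
  by rewrite -EFinM mulr_natl.
apply: (@integrable_sum _ _ _ P setT) => // i _.
exact/integrableZl/has_moments_integrableM.
Qed.

Lemma has_momentsN X : has_moments X -> has_moments (fun w => - X w).
Proof.
by move=> /(has_momentsZ (-1)); congr has_moments; apply/funext => w; rewrite mulN1r.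
Qed.

Lemma has_momentsB X Y : has_moments X -> has_moments Y ->
  has_moments (fun w => X w - Y w).
Proof. by move=> hX /has_momentsN; exact: has_momentsD. Qed.

Lemma has_moments_sum (I : Type) (r : seq I) (F : I -> T -> R) :
  (forall i, has_moments (F i)) -> has_moments (fun w => \sum_(i <- r) F i w).
Proof.
move=> hF; elim: r => [|i r IH].
  rewrite (_ : (fun _ => _) = cst 0); first exact: has_moments_cst.
  by apply/funext => w; rewrite big_nil.
rewrite (_ : (fun _ => _) = (fun w => F i w + \sum_(j <- r) F j w)).
  exact: has_momentsD.
by apply/funext => w; rewrite big_cons.
Qed.

Lemma has_moments_prod (I : Type) (r : seq I) (F : I -> T -> R) :
  (forall i, has_moments (F i)) -> has_moments (fun w => \prod_(i <- r) F i w).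
Proof.
move=> hF; elim: r => [|i r IH].
  rewrite (_ : (fun _ => _) = cst 1); first exact: has_moments_cst.
  by apply/funext => w; rewrite big_nil.
rewrite (_ : (fun _ => _) = (fun w => F i w * \prod_(j <- r) F j w)).
  exact: has_momentsM.
by apply/funext => w; rewrite big_cons.
Qed.

Lemma has_momentsX X n : has_moments X -> has_moments (fun w => X w ^+ n).
Proof.
move=> hX; elim: n => [|n IH]; first exact: has_moments_cst.
rewrite (_ : (fun _ => _) = (fun w => X w * X w ^+ n)); first exact: has_momentsM.
by apply/funext => w; rewrite exprS.
Qed.

Lemma has_moments_integrable X : has_moments X -> P.-integrable setT (EFin \o X).
Proof. by move=> [_ /(_ 1)]; apply: eq_integrable => // w _ /=; rewrite expr1. Qed.

Definition Ex X : R := \int[P]_w X w.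

Lemma eq_Ex X Y : X =1 Y -> Ex X = Ex Y.
Proof. by move=> /funext ->. Qed.

Lemma ExD X Y : has_moments X -> has_moments Y ->
  Ex (fun w => X w + Y w) = Ex X + Ex Y.
Proof.
by move=> hX hY; apply: RintegralD => //; exact: has_moments_integrable.
Qed.

Lemma ExZ c X : has_moments X -> Ex (fun w => c * X w) = c * Ex X.
Proof. by move=> hX; apply: RintegralZl => //; exact: has_moments_integrable. Qed.

Lemma ExB X Y : has_moments X -> has_moments Y ->
  Ex (fun w => X w - Y w) = Ex X - Ex Y.
Proof.
by move=> hX hY; apply: RintegralB => //; exact: has_moments_integrable.
Qed.

Lemma Ex_cst c : Ex (cst c) = c.
Proof.
rewrite /Ex /Rintegral (eq_integral (cst c%:E))// integral_cst// [X in (_ * X)%E](@probability_setT _ _ _ P).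
by rewrite mule1.
Qed.

Lemma Ex_sum (I : Type) (r : seq I) (F : I -> T -> R) :
  (forall i, has_moments (F i)) ->
  Ex (fun w => \sum_(i <- r) F i w) = \sum_(i <- r) Ex (F i).
Proof.
move=> hF; elim: r => [|i r IH].
  by rewrite big_nil -[RHS]Ex_cst; apply: eq_Ex => w; rewrite big_nil.
rewrite big_cons -IH -ExD//; last exact: has_moments_sum.
by apply: eq_Ex => w; rewrite big_cons.
Qed.

Lemma Ex_ge0 X : (forall w, 0 <= X w) -> 0 <= Ex X.
Proof. by move=> X0; exact: Rintegral_ge0. Qed.

(* Under the product rule the joint law is the product of the marginal laws,
   so that Fubini's theorem applies. *)
Lemma indep_ExM X Y a b : has_moments X -> has_moments Y ->
  (forall A C : set R, measurable A -> measurable C ->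
    P ((X @^-1` A) `&` (Y @^-1` C)) = (P (X @^-1` A) * P (Y @^-1` C))%E) ->
  Ex (fun w => X w ^+ a * Y w ^+ b) =
  Ex (fun w => X w ^+ a) * Ex (fun w => Y w ^+ b).
Proof.
move=> hX hY XY; have [mX iX] := hX; have [mY iY] := hY.
pose RT := measurableTypeR R.
pose Xm : {mfun T >-> RT} := HB.pack X (isMeasurableFun.Build _ _ _ RT X mX).
pose Ym : {mfun T >-> RT} := HB.pack Y (isMeasurableFun.Build _ _ _ RT Y mY).
pose Z : T -> RT * RT := fun w => (X w, Y w).
have mZ : measurable_fun setT Z by exact: measurable_fun_pair.
pose Zm : {mfun T >-> (RT * RT)%type} :=
  HB.pack Z (isMeasurableFun.Build _ _ _ (RT * RT)%type Z mZ).
pose mu1 := distribution P Xm; pose mu2 := distribution P Ym.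
pose f (z : RT * RT) := ((z.1 : R) ^+ a * (z.2 : R) ^+ b)%:E.
have mf : measurable_fun setT f.
  apply/measurable_EFinP; apply: measurable_funM.
    by apply: measurable_funX; exact: measurable_fst.
  by apply: measurable_funX; exact: measurable_snd.
have eqZ : forall A, measurable A -> (mu1 \x mu2)%E A = distribution P Zm A.
  by apply: product_measure_unique => A C mA mC; exact: XY.
have fZ : P.-integrable setT (f \o Z).
  exact: eq_integrable (has_moments_integrableM a b hX hY).
have ipush : (distribution P Zm).-integrable setT f.
  exact: (@integrable_pushforward _ _ _ _ _ _ mZ P setT f mf fZ).
have eqi (h : RT * RT -> \bar R) :
    (\int[distribution P Zm]_z h z = \int[(mu1 \x mu2)]_z h z)%E.
  by apply: eq_measure_integral => A mA _; exact: (esym (eqZ A mA)).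
have iprod : (mu1 \x mu2)%E.-integrable setT f.
  by apply/integrableP; split => //; rewrite -eqi; case/integrableP : ipush.
have mk k : measurable_fun setT (fun x : RT => ((x : R) ^+ k)%:E).
  by apply/measurable_EFinP; exact: measurable_funX.
have law1 : (\int[mu1]_x ((x : R) ^+ a)%:E = (Ex (fun w => X w ^+ a))%:E)%E.
  rewrite (@integral_distribution _ _ _ RT _ P Xm)//; last exact: iX.
  by rewrite /Ex fineK//; exact: integrable_fin_num (iX a).
have law2 : (\int[mu2]_x ((x : R) ^+ b)%:E = (Ex (fun w => Y w ^+ b))%:E)%E.
  rewrite (@integral_distribution _ _ _ RT _ P Ym)//; last exact: iY.
  by rewrite /Ex fineK//; exact: integrable_fin_num (iY b).
have i1 : mu1.-integrable setT (fun x : RT => ((x : R) ^+ a)%:E).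
  exact: (@integrable_pushforward _ _ _ RT _ (X : T -> RT) mX P setT _ (mk a) (iX a)).
have i2 : mu2.-integrable setT (fun x : RT => ((x : R) ^+ b)%:E).
  exact: (@integrable_pushforward _ _ _ RT _ (Y : T -> RT) mY P setT _ (mk b) (iY b)).
apply: EFin_inj; rewrite EFinM -law1 -law2.
rewrite {1}/Ex fineK; last exact: integrable_fin_num fZ.
transitivity (\int[distribution P Zm]_z f z)%E.
  by rewrite (@integral_distribution _ _ _ _ _ P Zm).
rewrite eqi -(integral12_prod_meas1 iprod) /fubini_F/=.
under eq_integral do rewrite /f/=.
transitivity (\int[mu1]_x ((Ex (fun w => Y w ^+ b))%:E * ((x : R) ^+ a)%:E))%E.
  apply: eq_integral => x _; rewrite muleC -law2 -integralZl//.
by rewrite integralZl// law2 muleC.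
Qed.

End moment_algebra.

(** * Independence *)

Section independence.
Context {R : realType} {d : measure_display} {T : measurableType d}.
Variable P : probability T R.

(** For fixed [B], the finite measures [P (A & B)] and [P A * P B] in [A] agree on a pi-system,
    hence on the sigma-algebra it generates; [G setT] provides the exhausting sequence. *)
Lemma indep_g_sigmal (G : set (set T)) (B : set T) : setI_closed G -> G setT ->
  G `<=` measurable -> measurable B ->
  (forall A, G A -> P (A `&` B) = (P A * P B)%E) ->
  forall A, <<s G >> A -> P (A `&` B) = (P A * P B)%E.
Proof.
move=> IG GT mG mB GB A sA.
have PB0 : 0 <= fine (P B) by exact: fine_ge0.
have PBfin : P B \is a fin_num by exact: fin_num_measure.
pose m1 := mrestr P mB.
pose m2 := mscale (NngNum PB0) P.
have m1E C : m1 C = P (C `&` B) by [].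
have m2E C : m2 C = (P C * P B)%E by rewrite /m2 /mscale/= fineK// muleC.
rewrite -m1E -m2E; apply: (@g_sigma_algebra_measure_unique _ _ _ G mG (fun=> setT)) => //.
- by apply/seteqP; split => // w _; exists 0%N.
- by move=> C GC; apply: etrans (esym (m2E C)); exact: GB.
- move=> _; apply: (@le_lt_trans _ _ 1%E); last exact: ltry.
  by apply: probability_le1; exact: measurableI.
Qed.

Lemma indep_g_sigma (G1 G2 : set (set T)) :
  setI_closed G1 -> G1 setT -> G1 `<=` measurable ->
  setI_closed G2 -> G2 setT -> G2 `<=` measurable ->
  (forall A B, G1 A -> G2 B -> P (A `&` B) = (P A * P B)%E) ->
  forall A B, <<s G1 >> A -> <<s G2 >> B -> P (A `&` B) = (P A * P B)%E.
Proof.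
move=> I1 T1 m1 I2 T2 m2 G12 A B sA sB.
have mB : measurable B.
  exact: (smallest_sub (@sigma_algebra_measurable _ T) m2) sB.
apply: (indep_g_sigmal I1) sA => // {}A GA.
rewrite setIC muleC; apply: (indep_g_sigmal I2) sB => //; first exact: m1.
by move=> {mB}B GB; rewrite setIC muleC; exact: G12.
Qed.

(** The events on which [indep_processes] states the product rule, for fixed times. *)
Definition cylinders n (X : 'I_n -> T -> R) : set (set T) :=
  [set E | exists A : 'I_n -> set R, (forall i, measurable (A i)) /\
    E = \bigcap_(i in [set: 'I_n]) (X i @^-1` A i)].

Lemma cylinders_setI n (X : 'I_n -> T -> R) : setI_closed (cylinders X).
Proof.
move=> _ _ [A [mA ->]] [C [mC ->]]; exists (fun i => A i `&` C i); split.
  by move=> i; exact: measurableI.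
by rewrite -bigcapI; apply: eq_bigcapr => i _; rewrite preimage_setI.
Qed.

Lemma cylinders_setT n (X : 'I_n -> T -> R) : cylinders X setT.
Proof.
exists (fun=> setT); split=> //.
by apply/seteqP; split.
Qed.

Lemma cylinders_measurable n (X : 'I_n -> T -> R) :
  (forall i, measurable_fun setT (X i)) -> cylinders X `<=` measurable.
Proof.
move=> mX _ [A [mA ->]]; apply: fin_bigcap_measurable => //.
by move=> i _; rewrite -[X in measurable X]setTI; exact: mX.
Qed.

Lemma cylinders_lincomb n (X : 'I_n -> T -> R) (a : 'I_n -> R) (A : set R) :
  measurable A ->
  <<s cylinders X >> ((fun w => \sum_(i < n) a i * X i w) @^-1` A).
Proof.
move=> mA.
(* On [T] with the sigma-algebra of the cylinders, membership of preimages becomes measurability,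
   which linear combinations inherit. *)
pose S := g_sigma_algebraType (cylinders X).
have mX i : measurable_fun setT (X i : S -> R).
  move=> _ C mC; rewrite setTI; apply: sub_sigma_algebra.
  exists (fun j => if j == i then C else setT); split.
    by move=> j; case: ifP.
  apply/seteqP; split=> [w Cw j _|w /(_ i Logic.I)] /=.
    by case: eqP => // ->.
  by rewrite eqxx.
have : measurable_fun setT ((fun w => \sum_(i < n) a i * X i w) : S -> R).
  by apply: measurable_sum => i; exact: measurable_funM.
by move=> /(_ measurableT _ mA); rewrite setTI.
Qed.

Lemma indep_lincomb (X Y : R -> T -> R) n (t : 'I_n -> R) (a b : 'I_n -> R) :
  indep_processes P X Y -> (forall i, 0 <= t i) ->
  (forall i, measurable_fun setT (X (t i))) ->
  (forall i, measurable_fun setT (Y (t i))) ->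
  let U := fun w => \sum_(i < n) a i * X (t i) w in
  let V := fun w => \sum_(i < n) b i * Y (t i) w in
  forall A C : set R, measurable A -> measurable C ->
    P ((U @^-1` A) `&` (V @^-1` C)) = (P (U @^-1` A) * P (V @^-1` C))%E.
Proof.
move=> XY t0 mX mY U V A C mA mC.
apply: (@indep_g_sigma (cylinders (X \o t)) (cylinders (Y \o t))).
- exact: cylinders_setI.
- exact: cylinders_setT.
- exact: cylinders_measurable.
- exact: cylinders_setI.
- exact: cylinders_setT.
- exact: cylinders_measurable.
- by move=> _ _ [E [mE ->]] [F [mF ->]]; exact: XY.
- exact: cylinders_lincomb.
- exact: cylinders_lincomb.
Qed.

End independence.

(** * Wick's formula *)

Section jets.
Context {R : realType}.
Implicit Types f g : R -> R.

(* f is a polynomial function with f(0) = a and f'(0) = b. *)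
Definition jet f (a b : R) :=
  exists2 p : {poly R}, (forall t, f t = p.[t]) & p`_0 = a /\ p`_1 = b.

(** The difference vanishes at as many distinct naturals as its size. *)
Lemma horner_inj (p q : {poly R}) : (forall t, p.[t] = q.[t]) -> p = q.
Proof.
move=> pq; apply/eqP; rewrite -subr_eq0; apply/eqP.
apply: (@roots_geq_poly_eq0 _ _ [seq n%:R | n <- iota 0 (size (p - q))]).
- by apply/allP => x _; rewrite rootE hornerD hornerN pq subrr.
- rewrite map_inj_uniq ?iota_uniq// => m n /eqP.
  by rewrite eqr_nat => /eqP.
- by rewrite size_map size_iota.
Qed.

(** Comparing the linear coefficients of two expressions of one function takes the place of
    differentiating under the expectation. *)
Lemma jet_uniq f a b a' b' : jet f a b -> jet f a' b' -> b = b'.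
Proof.
move=> [p fp [_ <-]] [q fq [_ <-]].
by have -> : p = q by apply: horner_inj => t; rewrite -fp fq.
Qed.

Lemma jetD f g a b a' b' : jet f a b -> jet g a' b' ->
  jet (fun t => f t + g t) (a + a') (b + b').
Proof.
move=> [p fp [p0 p1]] [q fq [q0 q1]]; exists (p + q).
  by move=> t; rewrite hornerD fp fq.
by rewrite !coefD p0 p1 q0 q1.
Qed.

Lemma jetM f g a b a' b' : jet f a b -> jet g a' b' ->
  jet (fun t => f t * g t) (a * a') (a * b' + b * a').
Proof.
move=> [p fp [p0 p1]] [q fq [q0 q1]]; exists (p * q).
  by move=> t; rewrite hornerM fp fq.
by rewrite !coefM !big_ord_recr !big_ord0/= !add0r p0 p1 q0 q1.
Qed.

Lemma jet_lin a b : jet (fun t => a + t * b) a b.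
Proof.
exists (a%:P + b *: 'X); first by move=> t; rewrite !hornerE mulrC.
by rewrite !coefE !mulr0 mulr1 addr0 add0r.
Qed.

Lemma jetZ c f a b : jet f a b -> jet (fun t => c * f t) (c * a) (c * b).
Proof.
move=> [p fp [p0 p1]]; exists (c *: p); first by move=> t; rewrite hornerZ fp.
by rewrite !coefZ p0 p1.
Qed.

Lemma jet_sum (I : Type) (r : seq I) (f : I -> R -> R) (a b : I -> R) :
  (forall i, jet (f i) (a i) (b i)) ->
  jet (fun t => \sum_(i <- r) f i t) (\sum_(i <- r) a i) (\sum_(i <- r) b i).
Proof.
move=> h; elim: r => [|i r [p fp [p0 p1]]].
  by exists 0 => [t|]; rewrite ?horner0 ?coef0 !big_nil.
have [q fq [q0 q1]] := h i; exists (q + p).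
  by move=> t; rewrite hornerD big_cons fp fq.
by rewrite !coefD !big_cons p0 p1 q0 q1.
Qed.

End jets.

(* All ways of extracting one occurrence from s, with what remains of s. *)
Fixpoint selections (I : Type) (s : seq I) : seq (I * seq I) :=
  if s is x :: s' then
    (x, s') :: [seq (p.1, x :: p.2) | p <- selections s'] else [::].

(* The sum over pairings of s, provided the fuel n is at least size s. *)
Fixpoint wick (R : pzRingType) (I : Type) (C : I -> I -> R) n (s : seq I) : R :=
  match n, s with
  | n.+1, x :: s' => \sum_(p <- selections s') C x p.1 * wick C n p.2
  | _, x :: s' => 0
  | _, [::] => 1
  end.

Section gaussian_space.
Context {R : realType} {d : measure_display} {T : measurableType d}.
Variable P : probability T R.
Local Notation has_moments := (has_moments P).
Local Notation Ex := (Ex P).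

(** By the binomial theorem the expectation is a polynomial in [t], whose coefficients are mixed
    moments. *)
Lemma jet_Ex (F X Z : T -> R) m :
  has_moments F -> has_moments X -> has_moments Z ->
  jet (fun t => Ex (fun w => F w * (X w + t * Z w) ^+ m))
    (Ex (fun w => F w * X w ^+ m))
    (m%:R * Ex (fun w => F w * Z w * X w ^+ m.-1)).
Proof.
move=> hF hX hZ.
pose c k := 'C(m, k)%:R * Ex (fun w => F w * (X w ^+ (m - k) * Z w ^+ k)).
have hk k : has_moments (fun w => F w * (X w ^+ (m - k) * Z w ^+ k)).
  by apply: has_momentsM => //; apply: has_momentsM; exact: has_momentsX.
exists (\poly_(k < m.+1) c k).
  move=> t; rewrite horner_poly.
  transitivity (Ex (fun w => \sum_(k < m.+1)
      ('C(m, k)%:R * t ^+ k) * (F w * (X w ^+ (m - k) * Z w ^+ k)))).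
    apply: eq_Ex => w; rewrite exprDn mulr_sumr; apply: eq_bigr => k _.
    by rewrite exprMn -mulr_natl; ring.
  rewrite Ex_sum; last by move=> k; exact: has_momentsZ.
  by apply: eq_bigr => k _; rewrite ExZ// /c mulrAC.
rewrite !coef_poly /=; split.
  by rewrite /c bin0 mul1r; apply: eq_Ex => w; rewrite subn0 expr0 mulr1.
case: m @c hk => [|m] c hk /=; first by rewrite mul0r.
rewrite /c bin1; congr (_ * _); apply: eq_Ex => w.
by rewrite subn1 expr1 mulrAC mulrA.
Qed.

(** The Gaussian space, reduced to what polarization needs: moments, stability along lines, and the
    one-dimensional recursion. *)
Variable V : set (T -> R).
Hypothesis V_moments : forall X, V X -> has_moments X.
Hypothesis V_line : forall X Z t, V X -> V Z -> V (fun w => X w + t * Z w).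
Hypothesis V_rec : forall X m, V X -> Ex (fun w => X w ^+ m.+1) =
  m%:R * Ex (fun w => X w ^+ 2) * Ex (fun w => X w ^+ m.-1).

(* Polarization: compare the terms linear in t of [V_rec] for X + t Z. *)
Lemma ibp_pow X Z m : V X -> V Z ->
  Ex (fun w => Z w * X w ^+ m) =
  m%:R * Ex (fun w => Z w * X w) * Ex (fun w => X w ^+ m.-1).
Proof.
move=> VX VZ; have hX := V_moments VX; have hZ := V_moments VZ.
have h1 := has_moments_cst P 1.
(* Strong induction, since the recursion lowers exponents by two. At exponent 0 the claim is that
   [Z] is centered, which is [V_rec] at 0. *)
have [n] := ubnP m; elim: n m => // n IH [|m] mn.
  rewrite !mul0r -[RHS](mul0r (Ex (fun w => Z w ^+ 2) * Ex (fun w => Z w ^+ 0.-1))).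
  rewrite mulrA -(V_rec 0 VZ); apply: eq_Ex => w.
  by rewrite expr0 expr1 mulr1.
have J k : jet (fun t => Ex (fun w => (X w + t * Z w) ^+ k))
    (Ex (fun w => X w ^+ k)) (k%:R * Ex (fun w => Z w * X w ^+ k.-1)).
  have [p fp [p0 p1]] := jet_Ex k h1 hX hZ; exists p.
    by move=> t; rewrite -fp; apply: eq_Ex => w; rewrite mul1r.
  rewrite p0 p1; split; first by apply: eq_Ex => w; rewrite mul1r.
  by congr (_ * _); apply: eq_Ex => w; rewrite mul1r.
have := jetM (jetZ m.+1%:R (J 2)) (J m).
have -> : (fun t => m.+1%:R * Ex (fun w => (X w + t * Z w) ^+ 2) *
      Ex (fun w => (X w + t * Z w) ^+ m)) =
    (fun t => Ex (fun w => (X w + t * Z w) ^+ m.+2)).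
  by apply/funext => t; rewrite (V_rec m.+1 (V_line t VX VZ)).
move=> /(jet_uniq (J m.+2)) /=.
have -> : Ex (fun w => Z w * X w ^+ 1) = Ex (fun w => Z w * X w).
  by apply: eq_Ex => w; rewrite expr1.
set c := Ex (fun w => Z w * X w).
case: m mn => [|m] mn.
  move=> _; rewrite mul1r.
  have -> : Ex (fun w => X w ^+ 0) = 1.
    by rewrite -[RHS](Ex_cst P); apply: eq_Ex => w; rewrite expr0.
  by rewrite mulr1; apply: eq_Ex => w; rewrite expr1.
rewrite (IH m); last by move: mn; rewrite ltnS => /ltnW.
rewrite -/c /= (V_rec m VX).
set e2 := Ex (fun w => X w ^+ 2); set em := Ex (fun w => X w ^+ m.-1).
set y := Ex _ => h.
have m0 : m.+3%:R != 0 :> R by rewrite pnatr_eq0.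
apply: (mulfI m0); rewrite h -!natr1; ring.
Qed.

Variables (I : Type) (u : I -> T -> R).
Hypothesis Vu : forall i, V (u i).

Let prodw (s : seq I) (w : T) : R := \prod_(i <- s) u i w.

Let hprod s : has_moments (prodw s).
Proof. by apply: has_moments_prod => i; exact: V_moments. Qed.

Let cov X Y := Ex (fun w => X w * Y w).

(** The power of [X] is a reservoir of factors for the induction on [s]: in the formula for [s] at
    exponent [m.+1] and [X + t * u c], the terms linear in [t] have one factor [X] replaced by
    [u c], which is the formula for [c :: s] at exponent [m]. *)
Lemma ibp_prod_pow b s X m : V b -> V X ->
  Ex (fun w => b w * prodw s w * X w ^+ m) =
  \sum_(p <- selections s) cov b (u p.1) * Ex (fun w => prodw p.2 w * X w ^+ m) +
  m%:R * cov b X * Ex (fun w => prodw s w * X w ^+ m.-1).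
Proof.
move=> Vb; elim: s X m => [|c s IH] X m VX.
  rewrite /= big_nil add0r -[X in _ * X]/(Ex _).
  have e F : (fun w => prodw [::] w * F w) = F.
    by apply/funext => w; rewrite /prodw big_nil mul1r.
  rewrite e -ibp_pow//; apply: eq_Ex => w.
  by rewrite /prodw big_nil mulr1.
have hb := V_moments Vb; have hX := V_moments VX; have hc := V_moments (Vu c).
have J0 := jet_Ex m.+1 (has_momentsM hb (hprod s)) hX hc.
have JC : jet (fun t => cov b (fun w => X w + t * u c w)) (cov b X) (cov b (u c)).
  have := jet_lin (cov b X) (cov b (u c)).
  congr (jet _ _ _); apply/funext => t.
  rewrite /cov -ExZ; last exact: has_momentsM.
  rewrite -ExD; [|exact: has_momentsM|exact/has_momentsZ/has_momentsM].
  by apply: eq_Ex => w; ring.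
have J1 := jetD (jet_sum (selections s) (fun p => jetZ (cov b (u p.1))
     (jet_Ex m.+1 (hprod p.2) hX hc)))
  (jetM (jetZ m.+1%:R JC) (jet_Ex m (hprod s) hX hc)).
have /jet_uniq := J0.
move: J1.
have -> : (fun t => \sum_(p <- selections s) cov b (u p.1) *
     Ex (fun w => prodw p.2 w * (X w + t * u c w) ^+ m.+1) +
   m.+1%:R * cov b (fun w => X w + t * u c w) *
     Ex (fun w => prodw s w * (X w + t * u c w) ^+ m)) =
  (fun t => Ex (fun w => b w * prodw s w * (X w + t * u c w) ^+ m.+1)).
  by apply/funext => t; rewrite (IH _ m.+1)//; exact: V_line.
move=> J1 /(_ _ _ J1) /=.
rewrite big_cons big_map /=.
have m0 : m.+1%:R != 0 :> R by rewrite pnatr_eq0.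
move=> h; apply: (mulfI m0).
transitivity (m.+1%:R * Ex (fun w => b w * prodw s w * u c w * X w ^+ m)).
  congr (_ * _); apply: eq_Ex => w; rewrite /prodw big_cons; ring.
rewrite h.
have e1 k : Ex (fun w => prodw (c :: s) w * X w ^+ k) =
    Ex (fun w => prodw s w * u c w * X w ^+ k).
  by apply: eq_Ex => w; rewrite /prodw big_cons; ring.
rewrite e1 !mulrDr mulr_sumr.
have -> : \sum_(j <- selections s) m.+1%:R * (cov b (u j.1) *
      Ex (fun w => prodw (c :: j.2) w * X w ^+ m)) =
    \sum_(i <- selections s) cov b (u i.1) *
      (m.+1%:R * Ex (fun w => prodw i.2 w * u c w * X w ^+ m)).
  apply: eq_bigr => p _; rewrite mulrCA; congr (_ * (_ * _)).
  by apply: eq_Ex => w; rewrite /prodw big_cons; ring.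
by rewrite -!mulrA; ring.
Qed.

(** The index type has no decidable equality, so [all] stands in for membership. *)
Lemma eq_sum_all (J : Type) (a : pred J) (l : seq J) (F G : J -> R) :
  all a l -> (forall j, a j -> F j = G j) ->
  \sum_(j <- l) F j = \sum_(j <- l) G j.
Proof.
move=> + FG; elim: l => [|j l IH] /=; first by rewrite !big_nil.
by move=> /andP[aj al]; rewrite !big_cons FG// IH.
Qed.

Lemma wick_formula n s : (size s <= n)%N ->
  Ex (prodw s) = wick (fun i j => cov (u i) (u j)) n s.
Proof.
elim: n s => [|n IH] [|x s] //= sn; try by
  rewrite -[RHS](Ex_cst P); apply: eq_Ex => w; rewrite /prodw big_nil.
(* The auxiliary variable occurs to the power 0; any element of [V] would do. *)
transitivity (Ex (fun w => u x w * prodw s w * u x w ^+ 0)).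
  by apply: eq_Ex => w; rewrite /prodw big_cons expr0 mulr1.
rewrite ibp_prod_pow// !mul0r addr0.
(* A selection shortens the list by one, so the remaining fuel suffices. *)
have sel : all (fun p => size p.2 == (size s).-1) (selections s).
  clear sn; elim: s => //= y s IHs; rewrite eqxx/= all_map.
  case: s IHs => // z s IHs; exact: sub_all IHs.
apply: (eq_sum_all sel) => p /eqP ps; congr (_ * _).
rewrite -IH ?ps; last by rewrite (leq_trans (leq_pred _)).
by apply: eq_Ex => w; rewrite expr0 mulr1.
Qed.

End gaussian_space.

(* The monomials, with coefficients, of the product over i in s of the
   centered squares x_i ^ 2 - C i i. *)
Fixpoint centered_squares (R : pzRingType) (I : Type) (C : I -> I -> R)
    (s : seq I) : seq (R * seq I) :=
  if s is i :: s' then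
    let r := centered_squares C s' in
    [seq (p.1, i :: i :: p.2) | p <- r] ++ [seq (- C i i * p.1, p.2) | p <- r]
  else [:: (1, [::])].

(** * Fourth moment of a sum of centered squares *)

Section fourth_moment.
Context {R : realType} {d : measure_display} {T : measurableType d}.
Variable P : probability T R.
Local Notation has_moments := (has_moments P).
Local Notation Ex := (Ex P).
Variable V : set (T -> R).
Hypothesis V_moments : forall X, V X -> has_moments X.
Hypothesis V_line : forall X Z t, V X -> V Z -> V (fun w => X w + t * Z w).
Hypothesis V_rec : forall X m, V X -> Ex (fun w => X w ^+ m.+1) =
  m%:R * Ex (fun w => X w ^+ 2) * Ex (fun w => X w ^+ m.-1).

Lemma Ex_prod_centered_squares (I : Type) (u : I -> T -> R) (s : seq I) n :
  (forall i, V (u i)) -> ((size s).*2 <= n)%N ->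
  let C i j := Ex (fun w => u i w * u j w) in
  Ex (fun w => \prod_(i <- s) (u i w ^+ 2 - C i i)) =
  \sum_(p <- centered_squares C s) p.1 * wick C n p.2.
Proof.
move=> Vu sn C.
have hp q : has_moments (fun w => \prod_(i <- q) u i w).
  by apply: has_moments_prod => i; exact: V_moments.
transitivity (Ex (fun w => \sum_(p <- centered_squares C s)
    p.1 * \prod_(i <- p.2) u i w)).
  apply: eq_Ex => w; elim: {sn}s => [|i s IH] /=.
    by rewrite big_nil big_seq1 big_nil mulr1.
  rewrite big_cons IH big_cat !big_map /= mulrBl !mulr_sumr -sumrN.
  by congr (_ + _); apply: eq_bigr => p _; rewrite ?big_cons ?expr2; ring.
rewrite Ex_sum; last by move=> p; exact: has_momentsZ.
have sz : all (fun p => size p.2 <= n)%N (centered_squares C s).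
  have: all (fun p => size p.2 <= (size s).*2)%N (centered_squares C s).
    elim: {sn}s => //= i s IH; rewrite all_cat !all_map; apply/andP; split.
      exact: sub_all IH.
    by apply: sub_all IH => p /= h; rewrite (leq_trans h)// doubleS -addn2 leq_addr.
  by apply: sub_all => p /= h; exact: leq_trans h sn.
apply: (eq_sum_all sz) => p ps.
by rewrite ExZ// (wick_formula V_moments V_line V_rec Vu ps).
Qed.

(** Centering cancels the pairings that join the two copies of an index. Of the remaining 60, three
    groups of 4 join the indices in two couples, and three groups of 16 form a cycle through all
    four. *)
Lemma Ex_centered_squares4 (I : Type) (u : I -> T -> R) i j k l :
  (forall i, V (u i)) ->
  let C i j := Ex (fun w => u i w * u j w) in
  let D i w := u i w ^+ 2 - C i i in
  Ex (fun w => D i w * D j w * D k w * D l w) =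
  4 * (C i j ^+ 2 * C k l ^+ 2 + C i k ^+ 2 * C j l ^+ 2 + C i l ^+ 2 * C j k ^+ 2)
  + 16 * (C i j * C j k * C k l * C i l + C i j * C j l * C k l * C i k
          + C i k * C j k * C j l * C i l).
Proof.
move=> Vu C D.
transitivity (Ex (fun w => \prod_(i <- [:: i; j; k; l]) (u i w ^+ 2 - C i i))).
  by apply: eq_Ex => w; rewrite !big_cons big_nil /D; ring.
rewrite (Ex_prod_centered_squares (n := 8) Vu)// -/C /=.
do 8 rewrite ?big_cons ?big_nil /=.
ring.
Qed.

End fourth_moment.

Section fourth_moment_sum.
Context {R : realType} {d : measure_display} {T : measurableType d}.
Variable P : probability T R.
Local Notation has_moments := (has_moments P).
Local Notation Ex := (Ex P).
Variable V : set (T -> R).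
Hypothesis V_moments : forall X, V X -> has_moments X.
Hypothesis V_line : forall X Z t, V X -> V Z -> V (fun w => X w + t * Z w).
Hypothesis V_rec : forall X m, V X -> Ex (fun w => X w ^+ m.+1) =
  m%:R * Ex (fun w => X w ^+ 2) * Ex (fun w => X w ^+ m.-1).

Lemma sum4_pairs N (a : 'I_N -> 'I_N -> R) :
  \sum_i \sum_j \sum_k \sum_l (a i j * a k l + a i k * a j l + a i l * a j k) =
  3 * (\sum_i \sum_j a i j) ^+ 2.
Proof.
pose F := fun i j k l => a i j * a k l.
have S : \sum_i \sum_j \sum_k \sum_l F i j k l = (\sum_i \sum_j a i j) ^+ 2.
  rewrite expr2 mulr_suml; apply: eq_bigr => i _.
  rewrite mulr_suml; apply: eq_bigr => j _.
  by rewrite mulr_sumr; apply: eq_bigr => k _; rewrite mulr_sumr.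
have S2 : \sum_i \sum_j \sum_k \sum_l F i k j l = (\sum_i \sum_j a i j) ^+ 2.
  by rewrite -S; apply: eq_bigr => i _; rewrite exchange_big.
have S3 : \sum_i \sum_j \sum_k \sum_l F i l j k = (\sum_i \sum_j a i j) ^+ 2.
  rewrite -S; apply: eq_bigr => i _.
  under eq_bigr => j _ do rewrite exchange_big.
  by rewrite exchange_big.
transitivity (\sum_i \sum_j \sum_k \sum_l F i j k l +
  \sum_i \sum_j \sum_k \sum_l F i k j l + \sum_i \sum_j \sum_k \sum_l F i l j k).
  rewrite -!big_split; apply: eq_bigr => i _.
  rewrite -!big_split; apply: eq_bigr => j _.
  rewrite -!big_split; apply: eq_bigr => k _.
  by rewrite -!big_split.
by rewrite S S2 S3; ring.
Qed.

Lemma expr4_sum N (a : 'I_N -> R) :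
  (\sum_i a i) ^+ 4 = \sum_i \sum_j \sum_k \sum_l a i * a j * a k * a l.
Proof.
rewrite !exprS expr0 mulr1 mulr_suml; apply: eq_bigr => i _.
rewrite mulr_suml mulr_sumr; apply: eq_bigr => j _.
rewrite mulr_suml !mulr_sumr; apply: eq_bigr => k _.
by rewrite !mulr_sumr; apply: eq_bigr => l _; rewrite !mulrA.
Qed.

Lemma Ex_sum_centered_squares4 N (u : 'I_N -> T -> R) : (forall i, V (u i)) ->
  let C i j := Ex (fun w => u i w * u j w) in
  is_true (Ex (fun w => (\sum_i (u i w ^+ 2 - C i i)) ^+ 4) <=
           60 * (\sum_i \sum_j C i j ^+ 2) ^+ 2).
Proof.
move=> Vu C.
pose D i w := u i w ^+ 2 - C i i.
have hD i : has_moments (D i).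
  apply: has_momentsB; last exact: has_moments_cst.
  exact/has_momentsX/V_moments.
have hD4 i j k l : has_moments (fun w => D i w * D j w * D k w * D l w).
  by do 3 apply: has_momentsM => //.
rewrite (@eq_Ex _ _ _ P _ (fun w => \sum_i \sum_j \sum_k \sum_l
   D i w * D j w * D k w * D l w)); last by move=> w; rewrite expr4_sum.
have e : Ex (fun w => \sum_i \sum_j \sum_k \sum_l D i w * D j w * D k w * D l w)
    = \sum_i \sum_j \sum_k \sum_l Ex (fun w => D i w * D j w * D k w * D l w).
  rewrite Ex_sum; last by move=> i; do 3 apply: has_moments_sum => ?.
  apply: eq_bigr => i _; rewrite Ex_sum; last by move=> j; do 2 apply: has_moments_sum => ?.
  apply: eq_bigr => j _; rewrite Ex_sum; last by move=> k; apply: has_moments_sum => ?.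
  by apply: eq_bigr => k _; rewrite Ex_sum.
(* 20 = 4 + 16: each cycle is a product of two of [x], [y], [z], and
   [xy + xz + yz <= x^2 + y^2 + z^2]. The 3 comes from [sum4_pairs] for the squared covariances. *)
rewrite e (_ : 60 = 20 * 3); last by ring.
rewrite -mulrA -sum4_pairs mulr_sumr; apply: ler_sum => i _.
rewrite mulr_sumr; apply: ler_sum => j _.
rewrite mulr_sumr; apply: ler_sum => k _.
rewrite mulr_sumr; apply: ler_sum => l _.
rewrite (Ex_centered_squares4 V_moments V_line V_rec i j k l Vu) -/C.
set x := C i j * C k l; set y := C i k * C j l; set z := C i l * C j k.
have -> : C i j * C j k * C k l * C i l = x * z by rewrite /x /z; ring.
have -> : C i j * C j l * C k l * C i k = x * y by rewrite /x /y; ring.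
have -> : C i k * C j k * C j l * C i l = y * z by rewrite /y /z; ring.
rewrite -!exprMn -/x -/y -/z.
have xy := sqr_ge0 (x - y); have xz := sqr_ge0 (x - z).
have yz := sqr_ge0 (y - z); nra.
Qed.

End fourth_moment_sum.

(** * Fractional Brownian increments *)

Section power_function.
Context {R : realType}.
Implicit Types x y h p : R.

Lemma powR_midpoint_convex p x y : 1 <= p -> 0 <= x -> 0 <= y ->
  ((x + y) / 2) `^ p <= (x `^ p + y `^ p) / 2.
Proof.
move=> p1 x0 y0.
have h0 : 0 <= (2^-1 : R) by rewrite invr_ge0.
have h1 : (2^-1 : R) <= 1 by rewrite invf_le1// ler1n.
rewrite !mulrDl ![_ / 2]mulrC {2 4}(_ : 2^-1 = 1 - 2^-1); last by field.
by apply: (convex_powR p1 (Itv01 h0 h1)); rewrite inE/= in_itv/= ?x0 ?y0.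
Qed.

(** Convexity of the inverse power [p^-1], applied at [x ^ p] and [y ^ p], followed by the
    increasing power [p]. *)
Lemma powR_midpoint_concave p x y : 0 < p <= 1 -> 0 <= x -> 0 <= y ->
  (x `^ p + y `^ p) / 2 <= ((x + y) / 2) `^ p.
Proof.
move=> /andP[p0 p1] x0 y0.
have q1 : 1 <= p^-1 by rewrite -[leLHS]invr1 lef_pV2 ?posrE.
have pq z : 0 <= z -> (z `^ p) `^ p^-1 = z.
  by move=> z0; rewrite -powRrM divff ?gt_eqF// powRr1.
have := powR_midpoint_convex q1 (powR_ge0 x p) (powR_ge0 y p).
rewrite !pq// => /(ge0_ler_powR (ltW p0)).
rewrite !nnegrE powR_ge0 divr_ge0 ?addr_ge0// => /(_ isT isT).
by rewrite -powRrM mulVf ?gt_eqF// powRr1// divr_ge0 ?addr_ge0 ?powR_ge0.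
Qed.

Lemma powR_increment_ge0 p x h : 0 < p -> 0 <= x -> 0 <= h ->
  0 <= (x + h) `^ p - x `^ p.
Proof.
by move=> p0 x0 h0; rewrite subr_ge0 ge0_ler_powR ?nnegrE ?addr_ge0 ?(ltW p0)// lerDl.
Qed.

(** With [y = x + h] and [r = x / y], the increment is [y^p (1 - r^p) <= y^p (1 - r^2) <= 2 y^p (1 -
    r)], and [1 - r = h / y]. Finally [y^p h / y] is at most [h] if [p >= 1], at most [h^p]
    otherwise. *)
Lemma powR_increment_le p x h : 0 < p <= 2 -> 0 <= x -> 0 < h -> x + h <= 1 ->
  (x + h) `^ p - x `^ p <= 2 * (h + h `^ p).
Proof.
move=> /andP[p0 p2] x0 h0 xh1.
set y := x + h; have y0 : 0 < y by rewrite /y ltr_wpDl.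
have hy : 0 < h / y <= 1.
  by rewrite divr_gt0// ler_pdivrMr// mul1r /y lerDr.
have yp : 0 <= y `^ p by exact: powR_ge0.
have bound : y `^ p * (h / y) <= h + h `^ p.
  have [p1|p1] := leP 1 p.
    have : y `^ p <= y by apply: ge1r_powR => //; rewrite y0.
    move=> /(ler_wpM2r (ltW (andP hy).1)) /le_trans; apply.
    by rewrite mulrCA divff ?gt_eqF// mulr1 lerDl powR_ge0.
  have : h / y <= (h / y) `^ p by apply: ger1_powR => //; exact: ltW.
  move=> /(ler_wpM2l yp) /le_trans; apply.
  rewrite -powRM ?(ltW y0)//; last exact: ltW (andP hy).1.
  by rewrite mulrCA divff ?gt_eqF// mulr1 lerDr ltW.
have xE : x `^ p = y `^ p * (x / y) `^ p.
  rewrite -powRM ?(ltW y0)//; last by rewrite divr_ge0// ltW.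
  by rewrite mulrCA divff ?gt_eqF// mulr1.
have xy1 : x / y <= 1 by rewrite ler_pdivrMr// mul1r /y lerDl ltW.
have sq : (x / y) ^+ 2 <= (x / y) `^ p.
  have [->|xN0] := eqVneq x 0; first by rewrite mul0r expr0n powR_ge0.
  have xy0 : 0 < x / y by rewrite divr_gt0// lt_neqAle eq_sym xN0.
  rewrite -powR_mulrn ?(ltW xy0)//.
  by apply: ger_powR => //; rewrite xy0.
apply: le_trans (ler_wpM2l _ bound) => //.
have -> : h / y = 1 - x / y by rewrite -[in RHS](divff (lt0r_neq0 y0)) -mulrBl /y addrAC subrr add0r.
rewrite xE; set r := x / y in sq xy1 *.
have : y `^ p * r ^+ 2 <= y `^ p * r `^ p by rewrite ler_wpM2l.
have : 0 <= y `^ p * (1 - r) ^+ 2 by rewrite mulr_ge0// sqr_ge0.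
set A := y `^ p; set B := A * _ `^ p; lra.
Qed.

End power_function.

(** * Sums of independent variables *)

Section independent_sum.
Context {R : realType} {d : measure_display} {T : measurableType d}.
Variable P : probability T R.
Local Notation has_moments := (has_moments P).
Local Notation Ex := (Ex P).
Implicit Types U W : T -> R.

Let moment_rec U (v : R) := forall n,
  Ex (fun w => U w ^+ n.+1) = n%:R * v * Ex (fun w => U w ^+ n.-1).

Let moments_product U W := forall a b, Ex (fun w => U w ^+ a * W w ^+ b) =
  Ex (fun w => U w ^+ a) * Ex (fun w => W w ^+ b).

(** The recursion for [U] acts on each term of the binomial expansion, and
    [(i+1) C(m+1, i+1) = (m+1) C(m, i)] reassembles the result. *)
Lemma indep_sum_ibp U W v m : has_moments U -> has_moments W ->
  moment_rec U v -> moments_product U W ->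
  Ex (fun w => U w * (W w + U w) ^+ m) =
  m%:R * v * Ex (fun w => (W w + U w) ^+ m.-1).
Proof.
move=> hU hW Uv UW.
have E0 : Ex U = 0.
  by have := Uv 0; rewrite mul0r mul0r => <-; apply: eq_Ex => w; rewrite expr1.
have expand k F n : has_moments F ->
    (forall w, F w = U w ^+ k * (W w + U w) ^+ n) ->
    Ex F = \sum_(i < n.+1)
      'C(n, i)%:R * (Ex (fun w => U w ^+ (k + i)) * Ex (fun w => W w ^+ (n - i))).
  move=> hF FE.
  transitivity (Ex (fun w => \sum_(i < n.+1)
      'C(n, i)%:R * (U w ^+ (k + i) * W w ^+ (n - i)))).
    apply: eq_Ex => w; rewrite FE exprDn mulr_sumr; apply: eq_bigr => i _.
    by rewrite -mulr_natl exprD; ring.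
  have h i : has_moments (fun w => U w ^+ (k + i) * W w ^+ (n - i)).
    by apply: has_momentsM; exact: has_momentsX.
  rewrite Ex_sum; last by move=> i; exact: has_momentsZ.
  by apply: eq_bigr => i _; rewrite ExZ// UW.
have hS n : has_moments (fun w => (W w + U w) ^+ n).
  by apply/has_momentsX/has_momentsD.
case: m => [|m].
  rewrite !mul0r -[RHS]E0; apply: eq_Ex => w.
  by rewrite expr0 mulr1.
rewrite (expand 1 _ m.+1); last 2 first.
- exact: has_momentsM.
- by move=> w; rewrite expr1.
rewrite (expand 0 _ m); last 2 first.
- exact: hS.
- by move=> w; rewrite expr0 mul1r.
rewrite big_ord_recl /= Uv !mul0r mulr0 add0r mulr_sumr.
apply: eq_bigr => i _.
rewrite /bump/= !add1n subSS Uv add0n /=.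
have : m.+1%:R * 'C(m, i)%:R = i.+1%:R * 'C(m.+1, i.+1)%:R :> R.
  by rewrite -!natrM (mul_bin_diag m.+1).
move=> e; rewrite mulrA mulrA [_ * (_ * v)]mulrA [_ * i.+1%:R]mulrC -e.
ring.
Qed.

(** Adding the two integrations by parts shows that the recursion survives independent sums, with no
    convolution of normal laws. *)
Lemma indep_sum_moment_rec U W u v m : has_moments U -> has_moments W ->
  moment_rec U u -> moment_rec W v -> moments_product U W ->
  Ex (fun w => (U w + W w) ^+ m.+1) =
  m%:R * Ex (fun w => (U w + W w) ^+ 2) * Ex (fun w => (U w + W w) ^+ m.-1).
Proof.
move=> hU hW Uu Wv UW.
have WU : moments_product W U.
  by move=> a b; rewrite mulrC -UW; apply: eq_Ex => w; rewrite mulrC.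
have hS n : has_moments (fun w => (U w + W w) ^+ n).
  by apply/has_momentsX/has_momentsD.
have e n : Ex (fun w => (U w + W w) ^+ n.+1) =
    n%:R * (u + v) * Ex (fun w => (U w + W w) ^+ n.-1).
  have iU := indep_sum_ibp n hU hW Uu UW.
  have iW := indep_sum_ibp n hW hU Wv WU.
  have c k : Ex (fun w => (W w + U w) ^+ k) = Ex (fun w => (U w + W w) ^+ k).
    by apply: eq_Ex => w; rewrite addrC.
  rewrite c in iU.
  transitivity (Ex (fun w => U w * (W w + U w) ^+ n + W w * (U w + W w) ^+ n)).
    by apply: eq_Ex => w; rewrite exprS (addrC (W w)) mulrDl.
  rewrite ExD; last 2 first.
  - apply: has_momentsM => //; exact/has_momentsX/has_momentsD.
  - exact: has_momentsM.
  by rewrite iU iW; ring.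
rewrite e (e 1); congr (_ * _ * _).
have -> : Ex (fun w => (U w + W w) ^+ 1.-1) = 1.
  by rewrite -[RHS](Ex_cst P); apply: eq_Ex => w; rewrite expr0.
by rewrite mul1r mulr1.
Qed.

End independent_sum.

(* One sign off the diagonal turns the signed total of c into the sum of its
   absolute values, up to the diagonal. *)
Lemma sum_sq_one_sign {R : realFieldType} N (c : 'I_N -> 'I_N -> R) (D v : R) :
  0 <= D -> D <= v -> 1 <= N%:R * v ->
  (forall j, c j j = D) -> (forall j k, `|c j k| <= D) ->
  \sum_j \sum_k c j k = 1 ->
  (forall j k, j != k -> 0 <= c j k) \/ (forall j k, j != k -> c j k <= 0) ->
  \sum_j \sum_k c j k ^+ 2 <= 2 * N%:R * v ^+ 2.
Proof.
move=> D0 Dv Nv cD cle c1 cs.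
have N0 : 0 <= N%:R :> R by [].
have v0 : 0 <= v by exact: le_trans Dv.
have [cpos|cneg] := cs.
  (* Here [1 <= N v] enters: [D <= v <= N v^2]. *)
  apply: (@le_trans _ _ D); last by nra.
  rewrite -[leRHS]mulr1 -c1 mulr_sumr; apply: ler_sum => j _.
  rewrite mulr_sumr; apply: ler_sum => k _.
  have c0 : 0 <= c j k by have [->|/cpos//] := eqVneq j k; rewrite cD.
  by rewrite expr2 ler_wpM2r// -(ger0_norm c0).
apply: (@le_trans _ _ (\sum_j \sum_k D * ((if j == k then 2 * D else 0) - c j k))).
  apply: ler_sum => j _; apply: ler_sum => k _.
  rewrite -(real_normK (num_real (c j k))) expr2 ler_pM//.
  have [->|/cneg ck] := eqVneq j k; last by rewrite ler0_norm// sub0r.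
  by rewrite cD ger0_norm//; lra.
under eq_bigr do rewrite -mulr_sumr sumrB.
rewrite -mulr_sumr sumrB c1.
rewrite (eq_bigr (fun=> 2 * D)); last first.
  by move=> j _; rewrite -big_mkcond (big_pred1 j)// => k; rewrite eq_sym.
rewrite sumr_const card_ord -mulr_natr.
have : D * D <= v * v by rewrite ler_pM.
nra.
Qed.

(** * Moments of Gaussian processes and their increments *)

Section gaussian_process.
Context {R : realType} {d : measure_display} {T : measurableType d}.
Variable P : probability T R.
Local Notation has_moments := (has_moments P).
Local Notation Ex := (Ex P).
Variables (X : R -> T -> R) (K : R -> R -> R).
Hypothesis gpX : centered_gaussian_process P X K.

Let lincomb n (t a : 'I_n -> R) w := \sum_(i < n) a i * X (t i) w.

Lemma gp_lincomb_has_moments n (t a : 'I_n -> R) : (forall i, 0 <= t i) ->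
  has_moments (lincomb t a).
Proof. by move=> t0; exact: centered_gaussian_has_moments (gpX a t0). Qed.

Lemma gp_lincomb_moment n (t a : 'I_n -> R) m : (forall i, 0 <= t i) ->
  Ex (fun w => lincomb t a w ^+ m.+1) =
  m%:R * (\sum_(i < n) \sum_(j < n) a i * a j * K (t i) (t j)) *
    Ex (fun w => lincomb t a w ^+ m.-1).
Proof. by move=> t0; exact: centered_gaussian_moment (gpX a t0). Qed.

Lemma gp_lincomb_sq n (t a : 'I_n -> R) : (forall i, 0 <= t i) ->
  Ex (fun w => lincomb t a w ^+ 2) =
  \sum_(i < n) \sum_(j < n) a i * a j * K (t i) (t j).
Proof.
move=> t0; rewrite gp_lincomb_moment// mul1r -[RHS]mulr1; congr (_ * _).
by rewrite -[RHS](Ex_cst P); apply: eq_Ex => w; rewrite expr0.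
Qed.

Lemma gp_has_moments t : 0 <= t -> has_moments (X t).
Proof.
move=> t0; have := @gp_lincomb_has_moments 1 (fun=> t) (fun=> 1) (fun=> t0).
by congr has_moments; apply/funext => w; rewrite /lincomb big_ord1 mul1r.
Qed.

Lemma gp_Ex t : 0 <= t -> Ex (X t) = 0.
Proof.
move=> t0; have := @gp_lincomb_moment 1 (fun=> t) (fun=> 1) 0 (fun=> t0).
rewrite !mul0r => <-; apply: eq_Ex => w.
by rewrite /lincomb big_ord1 mul1r expr1.
Qed.

(** The hypothesis yields variances of linear combinations; the covariance is read off from that of
    [X s + X t]. *)
Lemma gp_cov s t : (forall s t, K s t = K t s) -> 0 <= s -> 0 <= t ->
  Ex (fun w => X s w * X t w) = K s t.
Proof.
move=> Ksym s0 t0; have hs := gp_has_moments s0; have ht := gp_has_moments t0.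
have sq r : 0 <= r -> Ex (fun w => X r w ^+ 2) = K r r.
  move=> r0; have := @gp_lincomb_sq 1 (fun=> r) (fun=> 1) (fun=> r0).
  rewrite !big_ord1 !mul1r => <-; apply: eq_Ex => w.
  by rewrite /lincomb big_ord1 mul1r.
pose tt (i : 'I_2) := if i == ord0 then s else t.
have tt0 i : 0 <= tt i by rewrite /tt; case: ifP.
have := @gp_lincomb_sq 2 tt (fun=> 1) tt0.
rewrite !big_ord_recl !big_ord0 /tt /= !mul1r !addr0 (Ksym t s).
have -> : (fun w => lincomb tt (fun=> 1) w ^+ 2) =
    (fun w => (X s w ^+ 2 + X t w ^+ 2) + 2 * (X s w * X t w)).
  apply/funext => w; rewrite /lincomb !big_ord_recl big_ord0 /tt /=; ring.
rewrite ExD; last 2 first.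
- by apply: has_momentsD; exact: has_momentsX.
- by apply: has_momentsZ; exact: has_momentsM.
rewrite ExD; [|exact: has_momentsX|exact: has_momentsX].
rewrite ExZ; last exact: has_momentsM.
rewrite !sq//; lra.
Qed.

End gaussian_process.

Lemma fbm_cov_sym {R : realType} (H s t : R) : fbm_cov H s t = fbm_cov H t s.
Proof. by rewrite /fbm_cov distrC [X in X - _]addrC. Qed.

(* Brownian motion is treated as fractional Brownian motion with H = 1/2. *)
Lemma fbm_cov_half {R : realType} (s t : R) : 0 <= s -> 0 <= t ->
  fbm_cov 2^-1 s t = bm_cov s t.
Proof.
move=> s0 t0; rewrite /fbm_cov /bm_cov mulfV// !powRr1//.
by have [st|ts] := leP s t; [rewrite ler0_norm|rewrite gtr0_norm]; lra.
Qed.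

Section fbm_increments.
Context {R : realType} {d : measure_display} {T : measurableType d}.
Variable P : probability T R.
Local Notation has_moments := (has_moments P).
Local Notation Ex := (Ex P).
Variables (X : R -> T -> R) (H : R).
Hypothesis H01 : 0 < H < 1.
Hypothesis gpX : centered_gaussian_process P X (fbm_cov H).
Variable N : nat.
Hypothesis N0 : (0 < N)%N.
Local Notation p := (2 * H).
Local Notation h := (N%:R^-1 : R).
Local Notation t j := (j%:R / N%:R : R).

Let incr (j : nat) w := X (t j.+1) w - X (t j) w.

Let p0 : 0 < p. Proof. by case/andP: H01 => H0 _; rewrite mulr_gt0. Qed.
Let h0 : 0 < h. Proof. by rewrite invr_gt0 ltr0n. Qed.
Let t0 j : 0 <= t j. Proof. by rewrite divr_ge0. Qed.
Let tS j : t j.+1 = t j + h. Proof. by rewrite -natr1 mulrDl mul1r. Qed.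

Lemma incr_has_moments j : has_moments (incr j).
Proof. by apply: has_momentsB; exact: gp_has_moments gpX _ (t0 _). Qed.

Lemma fbm_incr_covE j k : Ex (fun w => incr j w * incr k w) =
  (`|t j - t k + h| `^ p + `|t j - t k - h| `^ p - 2 * `|t j - t k| `^ p) / 2.
Proof.
have hm i : has_moments (X (t i)) by exact: gp_has_moments gpX _ (t0 i).
have hmm i l : has_moments (fun w => X (t i) w * X (t l) w) by exact: has_momentsM.
have -> : (fun w => incr j w * incr k w) = (fun w =>
    (X (t j.+1) w * X (t k.+1) w - X (t j.+1) w * X (t k) w) -
    (X (t j) w * X (t k.+1) w - X (t j) w * X (t k) w)).
  by apply/funext => w; rewrite /incr; ring.
rewrite ExB; [|exact: has_momentsB..].
rewrite !ExB// !(gp_cov gpX (@fbm_cov_sym _ H))// /fbm_cov.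
rewrite (_ : t j.+1 - t k.+1 = t j - t k); last by rewrite !tS; ring.
rewrite (_ : t j.+1 - t k = t j - t k + h); last by rewrite !tS; ring.
rewrite (_ : t j - t k.+1 = t j - t k - h); last by rewrite !tS; ring.
set a := `|_ + _| `^ _; set b := `|_ - h| `^ _; set c := `|_| `^ _.
by field.
Qed.

Lemma fbm_incr_var j : Ex (fun w => incr j w ^+ 2) = h `^ p.
Proof.
transitivity (Ex (fun w => incr j w * incr j w)).
  by apply: eq_Ex => w; rewrite expr2.
rewrite fbm_incr_covE subrr add0r sub0r normrN normr0 powR0 ?gt_eqF//.
by rewrite gtr0_norm//; lra.
Qed.

Let dist_ge j k : j != k -> h <= `|t j - t k|.
Proof.
move=> jk; rewrite -mulrBl normrM (gtr0_norm h0) -[leLHS]mul1r ler_wpM2r ?(ltW h0)//.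
wlog lt_jk : j k jk / (k < j)%N.
  move=> hw; move: (jk); rewrite neq_ltn => /orP[kj|jk'].
    by rewrite distrC; apply: hw => //; rewrite eq_sym.
  exact: hw.
rewrite -natrB ?(ltnW lt_jk)// ger0_norm// -[leLHS]/(1%:R) ler_nat subn_gt0//.
Qed.

(** The covariance is half a second difference of [x^p] with step [h] at the distance [x] of the
    grid points; off the diagonal [x >= h], so that [x - h] stays in the domain of convexity or
    concavity. *)
Lemma fbm_incr_cov_sign :
  (forall j k : nat, j != k -> 0 <= Ex (fun w => incr j w * incr k w)) \/
  (forall j k : nat, j != k -> Ex (fun w => incr j w * incr k w) <= 0).
Proof.
have E j k : j != k -> exists2 x, h <= x &
    Ex (fun w => incr j w * incr k w) = ((x - h) `^ p + (x + h) `^ p) / 2 - x `^ p.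
  move=> jk; have := dist_ge jk; rewrite fbm_incr_covE.
  move: (t j - t k) => a ha; exists `|a| => //.
  have [a0|a0] := leP 0 a.
    rewrite (ger0_norm a0) in ha *.
    rewrite (ger0_norm (_ : 0 <= a + h)) ?addr_ge0 ?(ltW h0)//.
    by rewrite (ger0_norm (_ : 0 <= a - h)) ?subr_ge0//; field.
  rewrite (ltr0_norm a0) in ha *.
  have -> : `|a + h| = - a - h by rewrite ler0_norm; lra.
  have -> : `|a - h| = - a + h by rewrite ler0_norm; have := h0; lra.
  by field.
have mid x : ((x - h) + (x + h)) / 2 = x by lra.
have hh := h0.
have [p1|p1] := leP 1 p; [left|right] => j k /E[x hx ->].
  rewrite subr_ge0 -[in leLHS](mid x); apply: powR_midpoint_convex => //; lra.
rewrite subr_le0 -[in leRHS](mid x); apply: powR_midpoint_concave; [|lra|lra].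
by rewrite p0 ltW.
Qed.

(** Cauchy-Schwarz for equal variances: the second moments of the sum and of the difference are
    nonnegative. *)
Lemma fbm_incr_cov_le j k : `|Ex (fun w => incr j w * incr k w)| <= h `^ p.
Proof.
have hj := incr_has_moments j; have hk := incr_has_moments k.
have hjk := has_momentsM hj hk.
have hj2 := has_momentsX 2 hj; have hk2 := has_momentsX 2 hk.
have sq (e : R) : e ^+ 2 = 1 ->
    0 <= 2 * h `^ p + 2 * e * Ex (fun w => incr j w * incr k w).
  move=> e1; have : 0 <= Ex (fun w => (incr j w + e * incr k w) ^+ 2).
    by apply: Ex_ge0 => w; exact: sqr_ge0.
  have -> : (fun w => (incr j w + e * incr k w) ^+ 2) =
    (fun w => incr j w ^+ 2 + incr k w ^+ 2 + 2 * e * (incr j w * incr k w)).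
    by apply/funext => w; rewrite sqrrD exprMn e1; ring.
  rewrite ExD; [|exact: has_momentsD|exact: has_momentsZ].
  by rewrite ExD// ExZ// !fbm_incr_var; lra.
have := sq 1 (expr1n _ _); have := sq (-1) (etrans (sqrrN 1) (expr1n _ _)).
rewrite ler_norml; set c := Ex _; set D := h `^ p => *.
by apply/andP; split; lra.
Qed.

Lemma fbm_incr_cov_sum :
  \sum_(j < N) \sum_(k < N) Ex (fun w => incr j w * incr k w) = 1.
Proof.
have hi (j : 'I_N) := incr_has_moments j.
have hX i : has_moments (X (t i)) by exact: gp_has_moments gpX _ (t0 i).
transitivity (Ex (fun w => (\sum_(j < N) incr j w) * \sum_(k < N) incr k w)).
  rewrite (@eq_Ex _ _ _ P _
    (fun w => \sum_(j < N) \sum_(k < N) incr j w * incr k w)).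
    rewrite Ex_sum; last by move=> j; apply: has_moments_sum => k; exact: has_momentsM.
    apply: eq_bigr => j _; rewrite Ex_sum// => k; exact: has_momentsM.
  by move=> w; rewrite mulr_suml; apply: eq_bigr => j _; rewrite mulr_sumr.
have tele w : \sum_(j < N) incr j w = X (t N) w - X (t 0%N) w.
  by rewrite -(big_mkord predT (incr^~ w)) telescope_sumr.
have hmm i l : has_moments (fun w => X (t i) w * X (t l) w) by exact: has_momentsM.
have -> : (fun w => (\sum_(j < N) incr j w) * (\sum_(k < N) incr k w)) = (fun w =>
    (X (t N) w * X (t N) w - X (t N) w * X (t 0%N) w) -
    (X (t 0%N) w * X (t N) w - X (t 0%N) w * X (t 0%N) w)).
  by apply/funext => w; rewrite tele; ring.
rewrite ExB; [|exact: has_momentsB..].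
rewrite !ExB// !(gp_cov gpX (@fbm_cov_sym _ H))// /fbm_cov.
have -> : t N = 1 by rewrite divff// pnatr_eq0 -lt0n.
rewrite mul0r !subrr subr0 sub0r normrN normr1 normr0 powR1 powR0 ?gt_eqF//.
by field.
Qed.

(** [v] is left free so that the estimate serves both [B] and [BH] with the variance of the mixed
    increments. *)
Lemma fbm_incr_cov_sq v : h <= v -> h `^ p <= v ->
  \sum_(j < N) \sum_(k < N) Ex (fun w => incr j w * incr k w) ^+ 2 <=
  2 * N%:R * v ^+ 2.
Proof.
move=> hv pv; apply: (@sum_sq_one_sign _ _
  (fun j k : 'I_N => Ex (fun w => incr j w * incr k w)) (h `^ p)) => //.
- by rewrite mulrC -ler_pdivrMr ?ltr0n// mul1r.
- by move=> j; rewrite -(fbm_incr_var j); apply: eq_Ex => w; rewrite expr2.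
- by move=> j k; exact: fbm_incr_cov_le.
- exact: fbm_incr_cov_sum.
- by have [s|s] := fbm_incr_cov_sign; [left|right] => j k jk; apply: s.
Qed.

End fbm_increments.

(** * The mixed process *)

Section mixed_increments.
Context {R : realType} {d : measure_display} {T : measurableType d}.
Variable P : probability T R.
Local Notation has_moments := (has_moments P).
Local Notation Ex := (Ex P).
Variables (B BH : R -> T -> R) (H : R).
Hypothesis H01 : 0 < H < 1.
Hypothesis gpB : centered_gaussian_process P B bm_cov.
Hypothesis gpBH : centered_gaussian_process P BH (fbm_cov H).
Hypothesis indepB : indep_processes P B BH.
Variable N : nat.
Hypothesis N0 : (0 < N)%N.
Local Notation p := (2 * H).
Local Notation h := (N%:R^-1 : R).
Local Notation t j := (j%:R / N%:R : R).

Let v := h + h `^ p.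

Let t0 j : 0 <= t j. Proof. by rewrite divr_ge0. Qed.
Let h0 : 0 < h. Proof. by rewrite invr_gt0 ltr0n. Qed.

Definition incr (X : R -> T -> R) (j : nat) w := X (t j.+1) w - X (t j) w.

Definition mixed_incr j w := incr B j w + incr BH j w.

Let half01 : 0 < (2^-1 : R) < 1.
Proof. by apply/andP; split; [rewrite invr_gt0|rewrite invf_lt1// ltr1n]. Qed.

Lemma bm_is_fbm : centered_gaussian_process P B (fbm_cov 2^-1).
Proof.
move=> n s a s0.
have -> : \sum_(i < n) \sum_(j < n) a i * a j * fbm_cov 2^-1 (s i) (s j) =
    \sum_(i < n) \sum_(j < n) a i * a j * bm_cov (s i) (s j).
  by apply: eq_bigr => i _; apply: eq_bigr => j _; rewrite fbm_cov_half.
exact: gpB.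
Qed.

Let lincomb (X : R -> T -> R) (a : 'I_N.+1 -> R) w := \sum_(i < N.+1) a i * X (t i) w.

(** The two coefficient vectors are kept apart so that independence applies to the two summands. *)
Definition grid_span : set (T -> R) :=
  [set X | exists a b, X = fun w => lincomb B a w + lincomb BH b w].

Let hB a : has_moments (lincomb B a).
Proof. exact: gp_lincomb_has_moments gpB _ _ _ (fun=> t0 _). Qed.

Let hBH a : has_moments (lincomb BH a).
Proof. exact: gp_lincomb_has_moments gpBH _ _ _ (fun=> t0 _). Qed.

Lemma lincomb_indep a b m n :
  Ex (fun w => lincomb B a w ^+ m * lincomb BH b w ^+ n) =
  Ex (fun w => lincomb B a w ^+ m) * Ex (fun w => lincomb BH b w ^+ n).
Proof.
apply: indep_ExM => // A C mA mC.
apply: (indep_lincomb (t := fun i : 'I_N.+1 => t i)) => // i.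
- by have [] := gp_has_moments gpB (t0 i).
- by have [] := gp_has_moments gpBH (t0 i).
Qed.

Lemma grid_span_has_moments X : grid_span X -> has_moments X.
Proof. by move=> [a [b ->]]; exact: has_momentsD. Qed.

Lemma grid_span_line X Z s : grid_span X -> grid_span Z ->
  grid_span (fun w => X w + s * Z w).
Proof.
move=> [a [b ->]] [a' [b' ->]].
exists (fun i => a i + s * a' i), (fun i => b i + s * b' i).
apply/funext => w; rewrite mulrDr addrACA; congr (_ + _);
  by rewrite mulr_sumr -big_split; apply: eq_bigr => i _ /=; ring.
Qed.

Lemma grid_span_moment X m : grid_span X -> Ex (fun w => X w ^+ m.+1) =
  m%:R * Ex (fun w => X w ^+ 2) * Ex (fun w => X w ^+ m.-1).
Proof.
move=> [a [b ->]].
apply: (indep_sum_moment_rec _ (hB a) (hBH b)).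
- by move=> n; exact: gp_lincomb_moment gpB _ _ _ n (fun=> t0 _).
- by move=> n; exact: gp_lincomb_moment gpBH _ _ _ n (fun=> t0 _).
- by move=> k l; exact: lincomb_indep.
Qed.

Lemma sum_delta n (f : nat -> R) j : (j < n)%N ->
  \sum_(i < n) (i == j :> nat)%:R * f i = f j.
Proof.
move=> jn; rewrite (bigD1 (Ordinal jn))//= eqxx mul1r big1 ?addr0// => i ij.
by rewrite (negbTE (_ : i != j :> nat)) ?mul0r.
Qed.

Lemma incr_lincomb X (j : 'I_N) :
  incr X j = lincomb X (fun i => (i == j.+1 :> nat)%:R - (i == j :> nat)%:R).
Proof.
apply/funext => w; rewrite /incr /lincomb.
under eq_bigr do rewrite mulrBl.
have jN : (j < N.+1)%N by rewrite ltnS ltnW.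
have jN' : (j.+1 < N.+1)%N by rewrite ltnS.
by rewrite sumrB (sum_delta (fun i => X (t i) w) jN') (sum_delta (fun i => X (t i) w) jN).
Qed.

Lemma mixed_incr_span (j : 'I_N) : grid_span (mixed_incr j).
Proof. by rewrite /mixed_incr !incr_lincomb; eexists; eexists. Qed.

Lemma mixed_incr_cov (j k : 'I_N) :
  Ex (fun w => mixed_incr j w * mixed_incr k w) =
  Ex (fun w => incr B j w * incr B k w) + Ex (fun w => incr BH j w * incr BH k w).
Proof.
have mB (i : 'I_N) : has_moments (incr B i) by rewrite incr_lincomb.
have mBH (i : 'I_N) : has_moments (incr BH i) by rewrite incr_lincomb.
have cross (i l : 'I_N) : Ex (fun w => incr B i w * incr BH l w) = 0.
  have EB : Ex (incr B i) = 0.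
    rewrite ExB; [|exact: gp_has_moments gpB _ (t0 _)..].
    by rewrite !(gp_Ex gpB)// subrr.
  have := lincomb_indep (fun k => (k == i.+1 :> nat)%:R - (k == i :> nat)%:R)
    (fun k => (k == l.+1 :> nat)%:R - (k == l :> nat)%:R) 1 1.
  rewrite -!incr_lincomb => e.
  have -> : (fun w => incr B i w * incr BH l w) =
      (fun w => incr B i w ^+ 1 * incr BH l w ^+ 1).
    by apply/funext => w; rewrite !expr1.
  rewrite e (_ : (fun w => incr B i w ^+ 1) = incr B i); last first.
    by apply/funext => w; rewrite expr1.
  by rewrite EB mul0r.
have -> : (fun w => mixed_incr j w * mixed_incr k w) = (fun w =>
    (incr B j w * incr B k w + incr BH j w * incr BH k w) +
    (incr B j w * incr BH k w + incr B k w * incr BH j w)).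
  by apply/funext => w; rewrite /mixed_incr; ring.
rewrite !ExD ?cross ?addr0//; try exact: has_momentsM;
  by apply: has_momentsD; exact: has_momentsM.
Qed.

Lemma mixed_incr_var (j : 'I_N) : Ex (fun w => mixed_incr j w * mixed_incr j w) = v.
Proof.
rewrite mixed_incr_cov; congr (_ + _).
  have := fbm_incr_var half01 bm_is_fbm N0 j.
  by rewrite mulfV// powRr1// ltW.
apply: etrans (fbm_incr_var H01 gpBH N0 j).
by apply: eq_Ex => w; rewrite expr2.
Qed.

(** By [(b + c)^2 <= 2 b^2 + 2 c^2], the two sums, each at most [2 N v^2], give the factor 8. *)
Lemma mixed_incr_cov_sq :
  \sum_(j < N) \sum_(k < N) Ex (fun w => mixed_incr j w * mixed_incr k w) ^+ 2 <=
  8 * N%:R * v ^+ 2.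
Proof.
have hv : h <= v by rewrite lerDl powR_ge0.
have pv : h `^ p <= v by rewrite lerDr ltW.
have SB := fbm_incr_cov_sq half01 bm_is_fbm N0 hv.
have SBH := fbm_incr_cov_sq H01 gpBH N0 hv pv.
rewrite mulfV// powRr1 ?(ltW h0)// in SB.
have {}SB := SB hv.
have -> : 8 * N%:R * v ^+ 2 = 2 * (2 * N%:R * v ^+ 2) + 2 * (2 * N%:R * v ^+ 2) by ring.
apply: (@le_trans _ _ (2 * (\sum_(j < N) \sum_(k < N)
    Ex (fun w => incr B j w * incr B k w) ^+ 2) + 2 * (\sum_(j < N) \sum_(k < N)
    Ex (fun w => incr BH j w * incr BH k w) ^+ 2))); last first.
  by apply: lerD; rewrite ler_wpM2l.
rewrite !mulr_sumr -big_split; apply: ler_sum => j _ /=.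
rewrite !mulr_sumr -big_split; apply: ler_sum => k _ /=.
rewrite mixed_incr_cov; set b := Ex _; set c := Ex _.
by have := sqr_ge0 (b - c); nra.
Qed.

Lemma mixed_fourth_moment :
  Ex (fun w => (\sum_(j < N) mixed_incr j w ^+ 2 - N%:R * v) ^+ 4) <=
  60 * (8 * N%:R * v ^+ 2) ^+ 2.
Proof.
have bound := Ex_sum_centered_squares4 grid_span_has_moments grid_span_line
  grid_span_moment mixed_incr_span.
rewrite (@eq_Ex _ _ _ P _ (fun w => (\sum_(i < N) (mixed_incr i w ^+ 2 -
    Ex (fun w0 => mixed_incr i w0 * mixed_incr i w0))) ^+ 4)); last first.
  move=> w; congr (_ ^+ 4); rewrite sumrB; congr (_ - _).
  under [in RHS]eq_bigr do rewrite mixed_incr_var.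
  by rewrite sumr_const card_ord mulr_natl.
apply: (le_trans bound); rewrite ler_wpM2l//.
rewrite ler_sqr ?nnegrE; first exact: mixed_incr_cov_sq.
- by apply: sumr_ge0 => j _; apply: sumr_ge0 => k _; exact: sqr_ge0.
- by rewrite mulr_ge0 ?sqr_ge0// mulr_ge0.
Qed.

Lemma mixed_incr_has_moments (j : 'I_N) : has_moments (mixed_incr j).
Proof. exact/grid_span_has_moments/mixed_incr_span. Qed.

End mixed_increments.

(** * Almost sure convergence *)

Section almost_sure_convergence.
Context {R : realType} {d : measure_display} {T : measurableType d}.
Variable P : probability T R.
Local Notation has_moments := (has_moments P).
Local Notation Ex := (Ex P).

Lemma sum_inv_sq_le (n : nat) : \sum_(0 <= k < n) (k.+1%:R ^- 2 : R) <= 2.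
Proof.
(* The sharper bound makes the induction go through by telescoping. *)
suff h : \sum_(0 <= k < n.+1) (k.+1%:R ^- 2 : R) <= 2 - n.+1%:R^-1.
  apply: (@le_trans _ _ (\sum_(0 <= k < n.+1) (k.+1%:R ^- 2 : R))).
    by rewrite big_nat_recr//= lerDl invr_ge0 exprn_ge0.
  by apply: (le_trans h); rewrite lerBlDr lerDl invr_ge0.
elim: n => [|n IH]; first by rewrite big_nat1 !mulr1n expr1n invr1; lra.
rewrite big_nat_recr//=; apply: (le_trans (lerD IH (lexx _))).
have x0 : 0 < (n.+1%:R : R) by rewrite ltr0n.
rewrite -[n.+2%:R]natr1; set x := n.+1%:R in x0 *.
rewrite -addrA lerD2l -subr_ge0.
have -> : - (x + 1)^-1 - (- x^-1 + (x + 1) ^- 2) = (x * (x + 1) ^+ 2)^-1.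
  by field; rewrite !gt_eqF// addr_gt0.
by rewrite invr_ge0 mulr_ge0 ?exprn_ge0 ?addr_ge0// ltW.
Qed.

(** Summing the expectations shows that the series of [f n ^+ 4] is integrable, hence almost surely
    finite, and its terms tend to 0. *)
Lemma fourth_moment_ae_cvg0 (f : nat -> T -> R) (C : R) :
  (forall n, has_moments (f n)) ->
  (forall n, Ex (fun w => f n w ^+ 4) <= C / n.+1%:R ^+ 2) ->
  {ae P, forall w, (fun n => f n w) @ \oo --> (0 : R)}.
Proof.
move=> hf fC.
pose g n w := f n w ^+ 4.
have g0 n w : 0 <= g n w by rewrite /g (exprM _ 2 2) sqr_ge0.
have C0 : 0 <= C.
  have := fC 0; rewrite expr1n divr1; apply: le_trans.
  exact: Ex_ge0 (g0 0).
have mg n : measurable_fun setT (EFin \o g n).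
  apply/measurable_EFinP; apply: measurable_funX.
  by have [] := hf n.
have ig n : (\int[P]_w (g n w)%:E = (Ex (g n))%:E)%E.
  have hg : has_moments (g n) by exact: has_momentsX.
  by rewrite /Ex fineK//; exact: integrable_fin_num (has_moments_integrable hg).
pose S w := (\sum_(0 <= n <oo) (g n w)%:E)%E.
have mS : measurable_fun setT S.
  apply: (@ge0_emeasurable_sum _ _ _ setT (fun n w => (g n w)%:E) predT) => //.
    by move=> n w _ _; rewrite lee_fin.
  by move=> n _; exact: mg.
have S0 w : (0 <= S w)%E by apply: nneseries_ge0 => n _ _; rewrite lee_fin.
have iS : (\int[P]_w S w <= (2 * C)%:E)%E.
  rewrite integral_nneseries; [|exact: measurableT|exact: mg|
    by move=> n w _; rewrite lee_fin].
  apply: lime_le.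
    by apply: is_cvg_nneseries => n _ _; apply: integral_ge0 => w _; rewrite lee_fin.
  near=> n.
  rewrite (eq_bigr (fun k => (Ex (g k))%:E)); last by move=> k _; rewrite ig.
  rewrite sumEFin lee_fin mulrC.
  apply: (@le_trans _ _ (C * \sum_(0 <= k < n) (k.+1%:R ^- 2))); last first.
    by rewrite ler_wpM2l// sum_inv_sq_le.
  by rewrite mulr_sumr; apply: ler_sum => k _; exact: fC.
have intS : P.-integrable setT S.
  apply/integrableP; split; first exact: mS.
  rewrite (eq_integral S); last by move=> w _; rewrite gee0_abs.
  by apply: le_lt_trans iS _; rewrite ltry.
apply: filterS (integrable_ae measurableT intS) => w /(_ Logic.I) Sfin.
have gw0 : (fun n => g n w) @ \oo --> (0 : R).
  apply: cvg_series_cvg_0; apply: nondecreasing_is_cvgn.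
    by apply: nondecreasing_series => n _ _.
  exists (fine (S w)) => _ [n _ <-].
  rewrite -lee_fin fineK// /series/= -sumEFin.
  by apply: nneseries_lim_ge => k _ _; rewrite lee_fin.
apply/cvgr0Pnorm_lt => e e0.
have e40 : 0 < e ^+ 4 by rewrite exprn_gt0.
move/cvgr0Pnorm_lt : gw0 => /(_ _ e40); apply: filterS => n.
by rewrite /g normrX ltr_pXn2r// ?nnegrE// ltW.
Unshelve. all: by end_near. Qed.

End almost_sure_convergence.

(** A deterministic bound along one path: [z] is the relative error without drift, and [e] a scale
    for the drift that also serves as the weight for the cross term. *)
Lemma quadratic_perturbation {R : realFieldType} N (y d : 'I_N -> R)
    (M s z e : R) :
  0 < M -> 0 < s -> 0 < e ->
  (\sum_j y j ^+ 2 - M) / M = z -> (\sum_j d j ^+ 2) / M <= 6 * e ^+ 2 ->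
  `|(\sum_j (s * y j - 2^-1 * s ^+ 2 * d j) ^+ 2) / M - s ^+ 2| <=
  s ^+ 2 * `|z| + s ^+ 3 * (e * (7 + `|z|)) + 2 * s ^+ 4 * e ^+ 2.
Proof.
move=> M0 s0 e0 zE dM.
have yM : (\sum_j y j ^+ 2) / M = 1 + z.
  by rewrite -zE mulrBl divff ?gt_eqF// addrC subrK.
set q := (\sum_j d j ^+ 2) / M in dM.
have q0 : 0 <= q by rewrite divr_ge0 ?(ltW M0)// sumr_ge0// => j _; exact: sqr_ge0.
pose c := (\sum_j y j * d j) / M.
have -> : (\sum_j (s * y j - 2^-1 * s ^+ 2 * d j) ^+ 2) / M - s ^+ 2 =
    s ^+ 2 * z - s ^+ 3 * c + 4^-1 * s ^+ 4 * q.
  have -> : \sum_j (s * y j - 2^-1 * s ^+ 2 * d j) ^+ 2 =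
      s ^+ 2 * \sum_j y j ^+ 2 - s ^+ 3 * \sum_j y j * d j +
      4^-1 * s ^+ 4 * \sum_j d j ^+ 2.
    rewrite !mulr_sumr -sumrB -big_split; apply: eq_bigr => j _ /=.
    by field.
  rewrite mulrDl mulrBl -!mulrA yM -/c -/q; ring.
(* AM-GM with weight e. *)
have cle : `|c| <= 2^-1 * (e * (1 + z) + q / e).
  rewrite normrM (gtr0_norm (_ : 0 < M^-1)) ?invr_gt0//.
  rewrite ler_pdivrMr// (le_trans (ler_norm_sum _ _ _))//.
  have -> : 2^-1 * (e * (1 + z) + q / e) * M =
      \sum_j 2^-1 * (e * y j ^+ 2 + d j ^+ 2 / e).
    rewrite -mulr_sumr big_split /= -mulr_sumr -mulr_suml -yM /q.
    by field; rewrite !gt_eqF.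
  apply: ler_sum => j _; rewrite normrM.
  rewrite -(real_normK (num_real (y j))) -(real_normK (num_real (d j))).
  set a := `|y j|; set b := `|d j|.
  rewrite -subr_ge0 (_ : _ - _ = (2 * e)^-1 * (e * a - b) ^+ 2).
    by rewrite mulr_ge0 ?sqr_ge0// invr_ge0 mulr_ge0// ltW.
  by field; rewrite gt_eqF.
have qe : q / e <= 6 * e by rewrite ler_pdivrMr// -mulrA -expr2.
have z1 : z <= `|z| by exact: ler_norm.
have z2 : 0 <= `|z| by [].
(* 7 = 1 + 6, from [1 + z] and [q / e <= 6 * e]; the factor 1/2 is dropped. *)
have cle' : `|c| <= e * (7 + `|z|).
  apply: (le_trans cle).
  have : e * z <= e * `|z| by rewrite ler_wpM2l// ltW.
  have : 0 <= e * `|z| by rewrite mulr_ge0// ltW.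
  lra.
apply: (le_trans (ler_normD _ _)); apply: lerD.
  apply: (le_trans (ler_normB _ _)); apply: lerD.
    by rewrite normrM (ger0_norm (sqr_ge0 s)).
  rewrite normrM (ger0_norm (exprn_ge0 _ (ltW s0))).
  by rewrite ler_wpM2l// exprn_ge0// ltW.
have s4 : 0 <= s ^+ 4 by rewrite exprn_ge0// ltW.
rewrite ger0_norm; last by rewrite mulr_ge0// mulr_ge0// invr_ge0.
have : s ^+ 4 * q <= s ^+ 4 * (6 * e ^+ 2) by rewrite ler_wpM2l.
have : 0 <= s ^+ 4 * e ^+ 2 by rewrite mulr_ge0// sqr_ge0.
lra.
Qed.

Section drift.
Context {R : realType}.
Variables (H : R) (N : nat).
Hypothesis H01 : 0 < H < 1.
Hypothesis N0 : (0 < N)%N.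
Local Notation p := (2 * H).
Local Notation h := (N%:R^-1 : R).
Local Notation t j := (j%:R / N%:R : R).

Definition drift_incr (j : nat) : R := (t j.+1 + t j.+1 `^ p) - (t j + t j `^ p).

(** The increments are nonnegative, so the sum of squares is at most their largest value,
    [3 (h + h^p)], times their telescoping sum 2. *)
Lemma drift_sum_sq : \sum_(j < N) drift_incr j ^+ 2 <= 6 * (h + h `^ p).
Proof.
have [H0 H1] := andP H01.
have p0 : 0 < p by rewrite mulr_gt0.
have h0 : 0 < h by rewrite invr_gt0 ltr0n.
have hp0 := powR_ge0 h p.
have NN : N%:R != 0 :> R by rewrite pnatr_eq0 -lt0n.
have tS j : t j.+1 = t j + h by rewrite -natr1 mulrDl mul1r.
have dE j : drift_incr j = h + ((t j + h) `^ p - t j `^ p).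
  by rewrite /drift_incr !tS; ring.
have t0 j : 0 <= t j by rewrite divr_ge0.
have dge j : 0 <= drift_incr j.
  by rewrite dE addr_ge0 ?(ltW h0)// powR_increment_ge0// ltW.
have dle (j : 'I_N) : drift_incr j <= 3 * (h + h `^ p).
  have : (t j + h) `^ p - t j `^ p <= 2 * (h + h `^ p).
    apply: powR_increment_le => //; first by rewrite p0 /=; lra.
    rewrite -tS ler_pdivrMr ?ltr0n// mul1r ler_nat; exact: ltn_ord.
  rewrite dE; lra.
have sum2 : \sum_(j < N) drift_incr j = 2.
  rewrite -(big_mkord predT drift_incr).
  rewrite (telescope_sumr (fun j => t j + t j `^ p))//.
  by rewrite divff// mul0r powR1 powR0 ?gt_eqF// addr0 subr0.
rewrite (_ : 6 * _ = 3 * (h + h `^ p) * 2); last by ring.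
rewrite -[X in _ <= _ * X]sum2 mulr_sumr; apply: ler_sum => j _.
by rewrite expr2 ler_wpM2r.
Qed.

End drift.

Lemma log_return {R : realType} {d : measure_display} {T : measurableType d}
    (S0 sigma H : R) (B BH : R -> T -> R)
    (N j : nat) (w : T) : 0 < S0 ->
  ln (mixed_price S0 sigma H B BH (j.+1%:R / N%:R) w /
      mixed_price S0 sigma H B BH (j%:R / N%:R) w) =
  sigma * mixed_incr B BH N j w - 2^-1 * sigma ^+ 2 * drift_incr H N j.
Proof.
move=> S00; rewrite /mixed_price -mulf_div divff ?gt_eqF// mul1r.
rewrite -expRN -expRD expRK /mixed_incr /incr /drift_incr; ring.
Qed.

Theorem theorem1 (R : realType) (d : measure_display) (T : measurableType d)
  (P : probability T R) (B BH : R -> T -> R) (H sigma S0 : R) :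
  0 < H < 1 -> 0 < sigma -> 0 < S0 ->
  centered_gaussian_process P B bm_cov ->
  centered_gaussian_process P BH (fbm_cov H) ->
  indep_processes P B BH ->
  {ae P, forall w,
     (fun N : nat => sigma_hat2 (mixed_price S0 sigma H B BH) H N w) @ \oo
       --> sigma ^+ 2}.
Proof.
move=> H01 sigma0 S00 gpB gpBH indepB.
pose v (n : nat) : R := n.+1%:R^-1 + n.+1%:R^-1 `^ (2 * H).
pose Z n w := (\sum_(j < n.+1) mixed_incr B BH n.+1 j w ^+ 2 - n.+1%:R * v n) /
  (n.+1%:R * v n).
have v0 n : 0 < v n by rewrite ltr_pwDl ?invr_gt0 ?ltr0n ?powR_ge0.
have Nv0 n : 0 < n.+1%:R * v n by rewrite mulr_gt0// ltr0n.
have hY n : has_moments P (fun w =>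
    \sum_(j < n.+1) mixed_incr B BH n.+1 j w ^+ 2 - n.+1%:R * v n).
  apply: has_momentsB; last exact: has_moments_cst.
  apply: has_moments_sum => j; apply: has_momentsX.
  exact: (mixed_incr_has_moments gpB gpBH).
have hZ n : has_moments P (Z n).
  have := has_momentsZ (n.+1%:R * v n)^-1 (hY n).
  by congr has_moments; apply/funext => w; rewrite /Z mulrC.
have aeZ : {ae P, forall w, (fun n => Z n w) @ \oo --> (0 : R)}.
  (* 3840 = 60 * 8^2; dividing [N^2 v^4] by [(N v)^4] leaves [1 / N^2]. *)
  apply: (fourth_moment_ae_cvg0 (C := 3840)) => // n.
  have -> : (fun w => Z n w ^+ 4) = (fun w => (n.+1%:R * v n) ^- 4 *
      (\sum_(j < n.+1) mixed_incr B BH n.+1 j w ^+ 2 - n.+1%:R * v n) ^+ 4).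
    by apply/funext => w; rewrite /Z exprMn exprVn mulrC.
  rewrite ExZ; last exact/has_momentsX.
  have := mixed_fourth_moment H01 gpB gpBH indepB (ltn0Sn n).
  rewrite -/(v n) => le4.
  have M4 : 0 < (n.+1%:R * v n) ^+ 4 by rewrite exprn_gt0.
  rewrite mulrC ler_pdivrMr// (le_trans le4)// le_eqVlt; apply/orP; left.
  have : n.+1%:R != 0 :> R by rewrite pnatr_eq0.
  by set x := n.+1%:R; move=> x0; apply/eqP; field.
apply: filterS aeZ => w Zw.
(* The drift contributes at most [6 v / (N v) = 6 / N], which is [6 * e n ^+ 2]. *)
pose e (n : nat) : R := Num.sqrt n.+1%:R^-1.
have e0 n : 0 < e n by rewrite sqrtr_gt0 invr_gt0 ltr0n.
have e2 n : e n ^+ 2 = n.+1%:R^-1 by rewrite sqr_sqrtr// invr_ge0.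
have ecvg : e @ \oo --> (0 : R).
  rewrite -[0]sqrtr0; apply: continuous_cvg; first exact: sqrt_continuous.
  exact: cvg_harmonic.
(* The shift discards [N = 0], where the mesh is undefined. *)
rewrite -(cvg_shiftS (fun N => sigma_hat2 (mixed_price S0 sigma H B BH) H N w)).
pose rhs n := sigma ^+ 2 * `|Z n w| + sigma ^+ 3 * (e n * (7 + `|Z n w|)) +
  2 * sigma ^+ 4 * e n ^+ 2.
have rhs0 : rhs @ \oo --> (0 : R).
  have nZ : (fun n => `|Z n w|) @ \oo --> (0 : R) by apply/norm_cvg0P.
  have -> : (0 : R) = sigma ^+ 2 * 0 + sigma ^+ 3 * (0 * (7 + 0)) +
    2 * sigma ^+ 4 * (0 * 0) by ring.
  apply: cvgD; last by apply: cvgM; [exact: cvg_cst|exact: cvgM].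
  apply: cvgD; first by apply: cvgM => //; exact: cvg_cst.
  apply: cvgM; first exact: cvg_cst.
  by apply: cvgM => //; apply: cvgD => //; exact: cvg_cst.
apply/subr_cvg0; apply/norm_cvg0P.
apply: (@squeeze_cvgr _ _ _ _ (cst 0) rhs); [|exact: cvg_cst|exact: rhs0].
near=> n; rewrite normr_ge0/=.
have -> : sigma_hat2 (mixed_price S0 sigma H B BH) H n.+1 w =
    (\sum_(j < n.+1) (sigma * mixed_incr B BH n.+1 j w -
       2^-1 * sigma ^+ 2 * drift_incr H n.+1 j) ^+ 2) / (n.+1%:R * v n).
  rewrite /sigma_hat2; under eq_bigr do rewrite log_return//.
  have -> : (n.+1%:R `^ (2 * H))^-1 = n.+1%:R^-1 `^ (2 * H) :> R.
    by rewrite -powR_inv1// powRAC powR_inv1// powR_ge0.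
  by rewrite -/(v n) mulrC invfM.
apply: quadratic_perturbation => //.
rewrite ler_pdivrMr// e2 (le_trans (drift_sum_sq H01 (ltn0Sn n)))// -/(v n).
by rewrite -mulrA mulKf// pnatr_eq0.
Unshelve. all: by end_near. Qed.
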